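(* Let $\mathfrak{g}=\mathfrak{q}(N)$, let $\chi$ be a nilpotent linear functional and let $\Gamma:\mathfrak{g}=\bigoplus_{j}\mathfrak{g}_j$ be a good $\mathbb{Z}$-grading for $\chi$. Then the superalgebras $\mathcal{W}_{\mathfrak{l}}$ are all isomorphic for different choices of ($\mathbb{Z}_2$-graded) isotropic subspaces $\mathfrak{l}\subset\mathfrak{g}_{-1}$; that is, $\mathcal{W}_{\mathfrak{l}_1}\cong\mathcal{W}_{\mathfrak{l}_2}$ as superalgebras for any two isotropic subspaces $\mathfrak{l}_1,\mathfrak{l}_2$ of $\mathfrak{g}_{-1}$.
   Context: The ground field is $\mathbb{C}$; everything is $\mathbb{Z}_2$-graded. $\mathfrak{g}=\mathfrak{q}(N)$ consists of all matrices $\begin{pmatrix} S & S'\\ S' & S\end{pmatrix}$, $S,S'$ complex $N\times N$ matrices; even if $S'=0$, odd if $S=0$; the bracket is the supercommutator. $\mathfrak{g}_{\bar0}\cong\mathfrak{gl}(N)$ via $S$. $\Pi:\mathfrak{g}\to\mathfrak{g}$ interchanges $S$ and $S'$. The form $(x,y)=\mathrm{otr}(xy)$, $\mathrm{otr}\begin{pmatrix} A & B \\ B & A \end{pmatrix}=\mathrm{trace}(B)$, is odd, nondegenerate, invariant, supersymmetric. $\chi\in\mathfrak{g}_{\bar0}^*$, extended by $\chi(\mathfrak{g}_{\bar1})=0$, is written $\chi=(E,\cdot)$ with $E\in\mathfrak{g}_{\bar1}$; $\chi$ is nilpotent if $e=\Pi(E)\in\mathfrak{gl}(N)$ is nilpotent.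 A $\mathbb{Z}$-grading $\Gamma:\mathfrak{g}=\bigoplus_j\mathfrak{g}_j$ of Lie superalgebras (compatible with the $\mathbb{Z}_2$-grading) is good for $\chi$ if the center of $\mathfrak{g}$ lies in $\mathfrak{g}_0$, $\chi(\mathfrak{g}_j)=0$ for $j\ne-2$, and $\mathfrak{g}_\chi=\{y:\chi([y,\mathfrak{g}])=0\}\subseteq\bigoplus_{j\ge0}\mathfrak{g}_j$. On $\mathfrak{g}_{-1}$ the form $\langle x,y\rangle=\chi([x,y])$ is even, nondegenerate, skew-supersymmetric; isotropic means isotropic for this form. For a $\mathbb{Z}_2$-graded isotropic subspace $\mathfrak{l}\subseteq\mathfrak{g}_{-1}$ put $\mathfrak{l}'=\{x\in\mathfrak{g}_{-1}:\langle x,\mathfrak{l}\rangle=0\}$, $\mathfrak{m}=\mathfrak{l}\oplus\bigoplus_{i\le-2}\mathfrak{g}_i$, $\mathfrak{m}'=\mathfrak{l}'\oplus\bigoplus_{i\le-2}\mathfrak{g}_i$. Let $I_{\mathfrak{l}}$ be the left ideal of $U(\mathfrak{g})$ generated by $a-\chi(a)$ for homogeneous $a\in\mathfrak{m}$; it is stable under $\mathrm{ad}\,\mathfrak{m}'$. The $W$-superalgebra associated to $\mathfrak{l}$ is $\mathcal{W}_{\mathfrak{l}}=(U(\mathfrak{g})/I_{\mathfrak{l}})^{\mathrm{ad}\,\mathfrak{m}'}=\{\bar y\in U(\mathfrak{g})/I_{\mathfrak{l}}:[b,y]\in I_{\mathfrak{l}}\ \forall b\in\mathfrak{m}'\}$,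 where $\bar y$ is the coset of $y\in U(\mathfrak{g})$, with product $\bar y_1\bar y_2=\overline{y_1y_2}$. *)

(* Defs.v *)
From HB Require Import structures.
From mathcomp Require Import all_boot all_order all_algebra ring_quotient.
From mathcomp Require Import finmap boolp reals complex monalg.

Set Implicit Arguments.
Unset Strict Implicit.
Unset Printing Implicit Defensive.

Import Order.TTheory GRing.Theory Num.Theory.
Local Open Scope ring_scope.
Local Open Scope quotient_scope.

Section LmodqDef.
Variables (K : comNzRingType) (V : lmodType K) (I : submodClosed V).

Definition submod_pred : {pred V} := I.

Fact submod_pred_zmod : zmod_closed submod_pred.
Proof.
split; first exact: (@rpred0 _ I).
by move=> x y Ix Iy; rewrite -scaleN1r; apply: (@rpredD _ I) => //; apply: rpredZ.
Qed.
HB.instance Definition _ := GRing.isZmodClosed.Build V submod_pred submod_pred_zmod.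

(* V / I as a K-module; [Quotient.quot] only provides the additive group. *)
Definition lmodq : Type := Quotient.quot submod_pred.
HB.instance Definition _ := GRing.Zmodule.on lmodq.
HB.instance Definition _ := EqQuotient.on lmodq.

End LmodqDef.

(* Locked, like the other definitions introduced by HB.lock below, so that
   unification does not unfold it down to the quotient construction. *)
HB.lock Definition to_lmodq (K : comNzRingType) (V : lmodType K)
    (I : submodClosed V) (x : V) : lmodq I :=
  \pi_(Quotient.quot (submod_pred I)) x.
Canonical to_lmodq_unlockable := Unlockable to_lmodq.unlock.

Section Lmodq.
Variables (K : comNzRingType) (V : lmodType K) (I : submodClosed V).
Local Notation lmodq := (lmodq I).
Local Notation to_lmodq := (to_lmodq I).

Lemma to_lmodq_eq x y : to_lmodq x = to_lmodq y <-> x - y \in I.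
Proof.
rewrite unlock -[x - y \in I]/(x - y \in submod_pred I) Quotient.idealrBE.
by split=> /eqP.
Qed.

Definition lmodq_scale (a : K) (w : lmodq) : lmodq := to_lmodq (a *: repr w).

Lemma to_lmodqK (w : lmodq) : to_lmodq (repr w) = w.
Proof. by rewrite unlock; apply: reprK. Qed.

Lemma to_lmodq_zmod : zmod_morphism to_lmodq.
Proof. by move=> x y; rewrite unlock !piE. Qed.
HB.instance Definition _ := GRing.isZmodMorphism.Build V lmodq to_lmodq to_lmodq_zmod.

Lemma to_lmodqZ a x : lmodq_scale a (to_lmodq x) = to_lmodq (a *: x).
Proof.
apply/to_lmodq_eq; rewrite -scalerBr rpredZ //.
by apply/to_lmodq_eq; rewrite to_lmodqK.
Qed.

Fact lmodq_scaleA a b w : lmodq_scale a (lmodq_scale b w) = lmodq_scale (a * b) w.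
Proof. by rewrite -[w]to_lmodqK !to_lmodqZ scalerA. Qed.
Fact lmodq_scale1 : left_id 1 lmodq_scale.
Proof. by move=> w; rewrite -[w]to_lmodqK !to_lmodqZ scale1r. Qed.
Fact lmodq_scaleDr : right_distributive lmodq_scale +%R.
Proof.
move=> a w v; rewrite -[w]to_lmodqK -[v]to_lmodqK -raddfD !to_lmodqZ.
by rewrite -raddfD scalerDr.
Qed.
Fact lmodq_scaleDl w : {morph lmodq_scale^~ w : a b / a + b}.
Proof. by move=> a b; rewrite -[w]to_lmodqK !to_lmodqZ scalerDl raddfD. Qed.
HB.instance Definition _ := GRing.Zmodule_isLmodule.Build K lmodq
  lmodq_scaleA lmodq_scale1 lmodq_scaleDr lmodq_scaleDl.

Fact to_lmodq_scalable : scalable to_lmodq.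
Proof. by move=> a x; rewrite -to_lmodqZ. Qed.
HB.instance Definition _ :=
  GRing.isScalable.Build K V lmodq _ to_lmodq to_lmodq_scalable.
End Lmodq.

Section Ideals.
Variables (K : comNzRingType) (A : algType K) (G : A -> Prop).

Definition lideal : {pred A} := fun x =>
  `[< exists2 s : seq (A * A), (forall p, p \in s -> G p.2)
      & x = \sum_(p <- s) p.1 * p.2 >].

Definition bideal : {pred A} := fun x =>
  `[< exists2 s : seq (A * A * A), (forall p, p \in s -> G p.1.2)
      & x = \sum_(p <- s) p.1.1 * p.1.2 * p.2 >].

Fact lideal_submod : subsemimod_closed lideal.
Proof.
split; first split.
- by apply/asboolP; exists [::]; rewrite ?big_nil.
- move=> x y /asboolP[s sG ->] /asboolP[t tG ->]; apply/asboolP.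
  exists (s ++ t); last by rewrite big_cat.
  by move=> p; rewrite mem_cat => /orP[/sG|/tG].
- move=> a x /asboolP[s sG ->]; apply/asboolP.
  exists [seq (a *: p.1, p.2) | p <- s]; first by move=> _ /mapP[p /sG Gp ->].
  by rewrite big_map scaler_sumr; apply: eq_bigr => p _; rewrite scalerAl.
Qed.

Fact bideal_submod : subsemimod_closed bideal.
Proof.
split; first split.
- by apply/asboolP; exists [::]; rewrite ?big_nil.
- move=> x y /asboolP[s sG ->] /asboolP[t tG ->]; apply/asboolP.
  exists (s ++ t); last by rewrite big_cat.
  by move=> p; rewrite mem_cat => /orP[/sG|/tG].
- move=> a x /asboolP[s sG ->]; apply/asboolP.
  exists [seq (a *: p.1.1, p.1.2, p.2) | p <- s].
    by move=> _ /mapP[p /sG Gp ->].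
  by rewrite big_map scaler_sumr; apply: eq_bigr => p _ /=; rewrite !scalerAl.
Qed.

HB.instance Definition _ := GRing.isSubSemiModClosed.Build K A lideal lideal_submod.
HB.instance Definition _ := GRing.isSubSemiModClosed.Build K A bideal bideal_submod.

Lemma lidealMl a x : x \in lideal -> a * x \in lideal.
Proof.
move=> /asboolP[s sG ->]; apply/asboolP.
exists [seq (a * p.1, p.2) | p <- s]; first by move=> _ /mapP[p /sG Gp ->].
by rewrite big_map mulr_sumr; apply: eq_bigr => p _; rewrite mulrA.
Qed.

Lemma bidealMl a x : x \in bideal -> a * x \in bideal.
Proof.
move=> /asboolP[s sG ->]; apply/asboolP.
exists [seq (a * p.1.1, p.1.2, p.2) | p <- s].
  by move=> _ /mapP[p /sG Gp ->].
by rewrite big_map mulr_sumr; apply: eq_bigr => p _; rewrite !mulrA.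
Qed.

Lemma bidealMr a x : x \in bideal -> x * a \in bideal.
Proof.
move=> /asboolP[s sG ->]; apply/asboolP.
exists [seq (p.1.1, p.1.2, p.2 * a) | p <- s].
  by move=> _ /mapP[p /sG Gp ->].
by rewrite big_map mulr_suml; apply: eq_bigr => p _; rewrite !mulrA.
Qed.

Lemma lideal_gen x : G x -> x \in lideal.
Proof.
move=> Gx; apply/asboolP; exists [:: (1, x)]; last by rewrite big_seq1 mul1r.
by move=> p /[!inE] /eqP ->.
Qed.

Lemma bideal_gen x : G x -> x \in bideal.
Proof.
move=> Gx; apply/asboolP; exists [:: (1, x, 1)].
  by move=> p /[!inE] /eqP ->.
by rewrite big_seq1 mul1r mulr1.
Qed.
End Ideals.

Section FreeAlgebra.
Variables (K : comNzRingType) (I : choiceType).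

Definition freealg : Type := {malg K[{fmonom I}]}.
HB.instance Definition _ := GRing.Lalgebra.on freealg.

(* [monalg] equips noncommutative monoid algebras with [lalgType] only. *)
Fact freealg_scaleAr (k : K) (x y : freealg) : k *: (x * y) = x * (k *: y).
Proof.
have ZU (c : K) (m : {fmonom I}) : k *: << c *g m >> = << k * c *g m >>.
  by apply/malgP => m'; rewrite mcoeffZ !mcoeffU mulrnAr.
rewrite (malgMEw (fsubset_refl _) (msuppZ_le k y)) malgME scaler_sumr.
apply: eq_bigr => i _; rewrite scaler_sumr; apply: eq_bigr => j _.
by rewrite ZU mcoeffZ mulrCA.
Qed.
HB.instance Definition _ := GRing.Lalgebra_isAlgebra.Build K freealg freealg_scaleAr.

End FreeAlgebra.

HB.lock Definition freegen (K : comNzRingType) (I : choiceType) (i : I) :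
  freealg K I := << fmu i >>.
Canonical freegen_unlockable := Unlockable freegen.unlock.

Section FreeAlgebraTheory.
Variables (K : comNzRingType) (I : choiceType).
Local Notation freealg := (freealg K I).
Local Notation freegen := (freegen K).

Section Lift.
Variables (A : algType K) (f : I -> A).

Definition fmonom_lift (m : {fmonom I}) : A := \prod_(i <- (m : seq I)) f i.

Fact fmonom_lift_mmorphism : mmorphism fmonom_lift.
Proof.
split; first by move=> x y; rewrite /fmonom_lift fmM big_cat.
by rewrite /fmonom_lift fm1 big_nil.
Qed.
HB.instance Definition _ :=
  monalg.isMultiplicative.Build _ _ fmonom_lift fmonom_lift_mmorphism.

Definition freealg_lift : freealg -> A := mmap (in_alg A) fmonom_lift.

Fact freealg_lift_zmod : zmod_morphism freealg_lift.
Proof. by move=> x y; apply: raddfB. Qed.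
HB.instance Definition _ :=
  GRing.isZmodMorphism.Build freealg A freealg_lift freealg_lift_zmod.

Fact freealg_lift_monoid : monoid_morphism freealg_lift.
Proof.
have [] := @commr_mmap_is_multiplicative _ _ _ (in_alg A) fmonom_lift.
  by move=> g m m'; rewrite /GRing.comm /= mulr_algl mulr_algr.
by [].
Qed.
HB.instance Definition _ :=
  GRing.isMonoidMorphism.Build freealg A freealg_lift freealg_lift_monoid.

Fact freealg_lift_scalable : scalable freealg_lift.
Proof. by move=> k x; rewrite [LHS]mmapZ /= mulr_algl. Qed.
HB.instance Definition _ :=
  GRing.isScalable.Build K freealg A _ freealg_lift freealg_lift_scalable.

Lemma freealg_liftE i : freealg_lift (freegen i) = f i.
Proof.
by rewrite unlock /freealg_lift mmapU /= scale1r mul1r /fmonom_lift fmU big_seq1.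
Qed.
End Lift.

Lemma freealg_ext (A : algType K) (f g : {lrmorphism freealg -> A}) :
  (forall i, f (freegen i) = g (freegen i)) -> f =1 g.
Proof.
move=> fg x.
have gens (m : {fmonom I}) : << m >> = \prod_(i <- (m : seq I)) freegen i.
  case: m => s; elim: s => [|i s IH]; first by rewrite big_nil -fmoneE.
  rewrite big_cons /= in IH *; rewrite -IH unlock.
  rewrite [RHS]fgmulUU mulr1; congr << _ *g _ >>.
  by rewrite fmuE /mmul /= fmmulE.
have liftE (h : {lrmorphism freealg -> A}) :
    h x = \sum_(m <- msupp x) x@_m *: \prod_(i <- (m : seq I)) h (freegen i).
  have xE : x = \sum_(m <- msupp x) x@_m *: \prod_(i <- (m : seq I)) freegen i.
    rewrite [LHS]monalgE; apply: eq_bigr => m _; rewrite -gens.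
    by apply/malgP => m'; rewrite mcoeffZ !mcoeffU mulrnAr mulr1.
  rewrite [in LHS]xE linear_sum; apply: eq_bigr => m _.
  by rewrite linearZ rmorph_prod.
rewrite !liftE; apply: eq_bigr => m _; congr (_ *: _).
by apply: eq_bigr => i _; rewrite fg.
Qed.
End FreeAlgebraTheory.

Section QueerDef.
Variables (R : realType) (N : nat).
Local Notation C := R[i].

(* The pair (S, S') stands for the matrix queer_mx (S, S').  The alias keeps
   the componentwise product of pairs out of the way. *)
Definition queer : Type := ('M[C]_N * 'M[C]_N)%type.
HB.instance Definition _ := Vector.on queer.

Definition queer_mx (x : queer) : 'M[C]_(N + N) := block_mx x.1 x.2 x.2 x.1.

Definition qmul (x y : queer) : queer :=
  (x.1 *m y.1 + x.2 *m y.2, x.1 *m y.2 + x.2 *m y.1).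

Lemma queer_mxM x y : queer_mx (qmul x y) = queer_mx x *m queer_mx y.
Proof.
rewrite /queer_mx mulmx_block /=.
by rewrite [x.2 *m y.1 + _]addrC [x.2 *m y.2 + _]addrC.
Qed.

(* The parity is a boolean: false is even, true is odd. *)
Definition qhomog (p : bool) (x : queer) : bool :=
  if p then x.1 == 0 else x.2 == 0.

Definition qcomp (p : bool) (x : queer) : queer :=
  if p then (0, x.2) else (x.1, 0).

Definition qpar (x : queer) : queer := (x.1, - x.2).

End QueerDef.

(* The supercommutator, extended bilinearly from the homogeneous components *)
HB.lock Definition qbr (R : realType) (N : nat) (x y : queer R N) : queer R N :=
  \sum_(p : bool) \sum_(q : bool)
    (qmul (qcomp p x) (qcomp q y)
     - (-1) ^+ (p && q) *: qmul (qcomp q y) (qcomp p x)).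
Canonical qbr_unlockable := Unlockable qbr.unlock.

Section Queer.
Variables (R : realType) (N : nat).
Local Notation C := R[i].
Local Notation queer := (queer R N).

Definition qPi (x : queer) : queer := (x.2, x.1).
Definition otr (x : queer) : C := \tr x.2.
Definition qform (x y : queer) : C := otr (qmul x y).

(* chi is zero on the odd part and equals (E, .) with E odd; the even matrix
   e = Pi(E) is identified with its diagonal block in gl(N). *)
Definition nilpotent_functional (chi : {scalar queer}) : Prop :=
  (forall x, qhomog true x -> chi x = 0) /\
  exists E : queer, [/\ qhomog true E, forall x, chi x = qform E x
    & exists k : nat, (qPi E).1 ^+ k = 0].

(* The sum of the G j over the degrees j satisfying P *)
Definition gr_span (G : int -> {vspace queer}) (P : pred int) (x : queer) : Prop :=
  exists2 s : seq (int * queer),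
    (forall t, t \in s -> P t.1 /\ t.2 \in G t.1) & x = \sum_(t <- s) t.2.

(* g is the direct sum of the G j (independence of every finite subfamily, and
   spanning), every G j is a Z/2-graded subspace, [G j, G k] <= G (j + k). *)
Definition grading (G : int -> {vspace queer}) : Prop :=
  [/\ forall s : seq int, uniq s -> directv (\sum_(j <- s) G j)%VS,
      forall x, gr_span G predT x,
      forall j p x, x \in G j -> qcomp p x \in G j
    & forall j k x y, x \in G j -> y \in G k -> qbr x y \in G (j + k)].

Definition good_grading (chi : {scalar queer}) (G : int -> {vspace queer}) : Prop :=
  [/\ grading G,
      forall z, (forall x, qbr z x = 0) -> z \in G 0,
      forall j x, j != - 2%:Z -> x \in G j -> chi x = 0
    & forall y, (forall x, chi (qbr y x) = 0) -> gr_span G (fun j => 0 <= j) y].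

Definition isotropic (chi : {scalar queer}) (G : int -> {vspace queer})
    (l : {vspace queer}) : Prop :=
  [/\ (l <= G (- 1)%R)%VS, forall p x, x \in l -> qcomp p x \in l
    & forall x y, x \in l -> y \in l -> chi (qbr x y) = 0].

(* (-1) ^+ (p && q) is the sign (-1)^{pq} of the two parities. *)
Inductive env_rel : freealg C queer -> Prop :=
| env_rel_linear a x y :
    env_rel (freegen C (a *: x + y) - (a *: freegen C x + freegen C y))
| env_rel_bracket p q x y : qhomog p x -> qhomog q y ->
    env_rel (freegen C x * freegen C y
             - (-1) ^+ (p && q) *: (freegen C y * freegen C x)
             - freegen C (qbr x y)).

End Queer.

Section MorphismsOnRelations.
Variables (K : comNzRingType) (A B : algType K) (f : {lrmorphism A -> B}).

Lemma lrmorph_lin_rel (k : K) (u v w : A) :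
  f (u - (k *: v + w)) = f u - (k *: f v + f w).
Proof. by rewrite raddfB; congr (_ - _); apply: linearP. Qed.

Lemma lrmorph_br_rel (k : K) (u v w : A) :
  f (u * v - k *: (v * u) - w) = f u * f v - k *: (f v * f u) - f w.
Proof.
rewrite raddfB; congr (_ - _); rewrite raddfB; congr (_ - _).
  exact: rmorphM.
by rewrite -rmorphM; apply: linearZ.
Qed.
End MorphismsOnRelations.

Section EnvDef.
Variables (R : realType) (N : nat).
Local Notation C := R[i].
Local Notation queer := (queer R N).

(* U(g) = T(g) modulo the supercommutation relations.  T(g) is presented as the
   free algebra on the set g modulo the linearity relations [env_rel_linear]. *)
Definition env : Type := lmodq (bideal (@env_rel R N)).
HB.instance Definition _ := GRing.Lmodule.on env.

Definition to_env : freealg C queer -> env := @to_lmodq _ _ (bideal (@env_rel R N)).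
HB.instance Definition _ := GRing.Linear.on to_env.

Lemma to_envK (u : env) : to_env (repr u) = u.
Proof. exact: to_lmodqK. Qed.

Lemma to_env_eq x y : to_env x = to_env y <-> x - y \in bideal (@env_rel R N).
Proof. exact: to_lmodq_eq. Qed.

End EnvDef.

HB.lock Definition env_mul (R : realType) (N : nat) (u v : env R N) : env R N :=
  to_env (repr u * repr v).
Canonical env_mul_unlockable := Unlockable env_mul.unlock.

Section Env.
Variables (R : realType) (N : nat).
Local Notation C := R[i].
Local Notation queer := (queer R N).
Local Notation env := (env R N).
Local Notation to_env := (@to_env R N).
Local Notation env_mul := (@env_mul R N).

Lemma to_envM x y : env_mul (to_env x) (to_env y) = to_env (x * y).
Proof.
rewrite unlock; apply/to_env_eq; set x' := repr _; set y' := repr _.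
have -> : x' * y' - x * y = x' * (y' - y) + (x' - x) * y.
  by rewrite mulrBr mulrBl addrA subrK.
rewrite rpredD //; [apply: bidealMl|apply: bidealMr];
  by apply/to_env_eq; rewrite to_envK.
Qed.

Fact env_mulA : associative env_mul.
Proof. by move=> u v w; rewrite -[u]to_envK -[v]to_envK -[w]to_envK !to_envM mulrA. Qed.
Fact env_mul1 : left_id (to_env 1) env_mul.
Proof. by move=> u; rewrite -[u]to_envK !to_envM mul1r. Qed.
Fact env_mulr1 : right_id (to_env 1) env_mul.
Proof. by move=> u; rewrite -[u]to_envK !to_envM mulr1. Qed.
Fact env_mulDl : left_distributive env_mul +%R.
Proof.
move=> u v w; rewrite -[u]to_envK -[v]to_envK -[w]to_envK.
by rewrite -raddfD !to_envM -raddfD mulrDl.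
Qed.
Fact env_mulDr : right_distributive env_mul +%R.
Proof.
move=> u v w; rewrite -[u]to_envK -[v]to_envK -[w]to_envK.
by rewrite -raddfD !to_envM -raddfD mulrDr.
Qed.

(* The constant coefficient vanishes on the relations, so U(g) is nontrivial. *)
Fact env_oner_neq0 : to_env 1 != 0.
Proof.
apply/eqP; rewrite -[0](raddf0 to_env) => /to_env_eq; rewrite subr0.
pose aug : {lrmorphism freealg C queer -> C^o} := freealg_lift (fun=> 0 : C^o).
have augM x y : aug (x * y) = aug x * aug y by apply: rmorphM.
move=> /asboolP[s sG] /(congr1 aug); rewrite rmorph1 raddf_sum big_seq big1.
  by move/eqP; rewrite oner_eq0.
move=> t /sG rel_t; rewrite /= !augM.
suff -> : aug t.1.2 = 0 by rewrite mulr0 mul0r.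
have gen0 i : aug (freegen C i) = 0 by apply: freealg_liftE.
case: rel_t => [a x y|p q x y _ _].
  by rewrite lrmorph_lin_rel !gen0 scaler0 addr0 subrr.
by rewrite lrmorph_br_rel !gen0 !mulr0 scaler0 !subr0.
Qed.

HB.instance Definition _ := GRing.Zmodule_isNzRing.Build env
  env_mulA env_mul1 env_mulr1 env_mulDl env_mulDr env_oner_neq0.

Fact to_env_monoid : monoid_morphism to_env.
Proof. by split; [exact: erefl|move=> x y; exact: (esym (to_envM x y))]. Qed.
HB.instance Definition _ :=
  GRing.isMonoidMorphism.Build (freealg C queer) env to_env to_env_monoid.

Lemma to_env_scale k x : k *: to_env x = to_env (k *: x).
Proof. by apply/esym; apply: linearZ. Qed.

Lemma to_env_mul x y : to_env x * to_env y = to_env (x * y).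
Proof. exact: to_envM. Qed.

Fact env_scaleAl (k : C) (u v : env) : k *: (u * v) = (k *: u) * v.
Proof.
rewrite -[u]to_envK -[v]to_envK.
by rewrite to_env_mul !to_env_scale to_env_mul scalerAl.
Qed.
HB.instance Definition _ := GRing.Lmodule_isLalgebra.Build C env env_scaleAl.
Fact env_scaleAr (k : C) (u v : env) : k *: (u * v) = u * (k *: v).
Proof.
rewrite -[u]to_envK -[v]to_envK.
by rewrite to_env_mul !to_env_scale to_env_mul scalerAr.
Qed.
HB.instance Definition _ := GRing.Lalgebra_isAlgebra.Build C env env_scaleAr.

Definition env_inj (x : queer) : env := to_env (freegen C x).

Fact env_inj_linear : linear env_inj.
Proof.
move=> a x y; apply/eqP; rewrite -subr_eq0 -lrmorph_lin_rel; apply/eqP.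
rewrite -[RHS](raddf0 to_env); apply/to_env_eq; rewrite subr0.
exact/bideal_gen/env_rel_linear.
Qed.
HB.instance Definition _ :=
  GRing.isLinear.Build C queer env _ env_inj env_inj_linear.

Lemma env_inj_br p q x y : qhomog p x -> qhomog q y ->
  env_inj (qbr x y)
  = env_inj x * env_inj y - (-1) ^+ (p && q) *: (env_inj y * env_inj x).
Proof.
move=> px qy; apply/esym/eqP; rewrite -subr_eq0 -lrmorph_br_rel; apply/eqP.
rewrite -[RHS](raddf0 to_env); apply/to_env_eq; rewrite subr0.
exact/bideal_gen/env_rel_bracket.
Qed.

Lemma env_ext (A : algType C) (f g : {lrmorphism env -> A}) :
  (forall x, f (env_inj x) = g (env_inj x)) -> f =1 g.
Proof.
move=> fg u; rewrite -[u]to_envK.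
exact: (@freealg_ext _ _ _ (f \o to_env) (g \o to_env)).
Qed.

Section Lift.
Variables (A : algType C) (f : {linear queer -> A}).
Hypothesis fbr : forall p q x y, qhomog p x -> qhomog q y ->
  f (qbr x y) = f x * f y - (-1) ^+ (p && q) *: (f y * f x).

Lemma freealg_lift_rel x : x \in bideal (@env_rel R N) -> freealg_lift f x = 0.
Proof.
move=> /asboolP[s sG ->]; rewrite raddf_sum big_seq big1 // => t /sG rel_t.
have fM y z : freealg_lift f (y * z) = freealg_lift f y * freealg_lift f z.
  exact: rmorphM.
rewrite /= !fM; suff -> : freealg_lift f t.1.2 = 0 by rewrite mulr0 mul0r.
case: rel_t => [a y z|p q y z py qz].
  by rewrite lrmorph_lin_rel /= !freealg_liftE linearP subrr.
by rewrite lrmorph_br_rel /= !freealg_liftE (fbr py qz) subrr.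
Qed.

Definition env_lift (u : env) : A := freealg_lift f (repr u).

Lemma env_liftE x : env_lift (to_env x) = freealg_lift f x.
Proof.
apply/eqP; rewrite -subr_eq0 -raddfB; apply/eqP/freealg_lift_rel.
by apply/to_env_eq; rewrite to_envK.
Qed.

Lemma env_lift_inj x : env_lift (env_inj x) = f x.
Proof. by rewrite env_liftE freealg_liftE. Qed.

Lemma env_lift_linear : linear env_lift.
Proof.
move=> a u v; rewrite -[u]to_envK -[v]to_envK -linearP !env_liftE.
exact: linearP.
Qed.

Lemma env_lift_monoid : monoid_morphism env_lift.
Proof.
split; first by rewrite -(rmorph1 to_env) env_liftE rmorph1.
move=> u v; rewrite -[u]to_envK -[v]to_envK to_env_mul !env_liftE.
exact: rmorphM.
Qed.
End Lift.

End Env.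

Section QueerTheory.
Variables (R : realType) (N : nat).
Local Notation C := R[i].
Local Notation queer := (queer R N).
Implicit Types (x y z : queer) (p q : bool).

Lemma qcompD p x y : qcomp p (x + y) = qcomp p x + qcomp p y.
Proof. by case: p; congr pair; rewrite /= ?addr0. Qed.

Lemma qcomp_sum x : qcomp false x + qcomp true x = x.
Proof. by case: x => a b; congr pair; rewrite /= ?addr0 ?add0r. Qed.

Lemma qcomp_homog p x : qhomog p (qcomp p x).
Proof. by case: p => /=. Qed.

Lemma qcomp_id p x : qhomog p x -> qcomp p x = x.
Proof. by case: x => a b; case: p => /eqP /= ->. Qed.

Lemma qcomp_neg p x : qhomog p x -> qcomp (~~ p) x = 0.
Proof. by case: x => a b; case: p => /eqP /= ->. Qed.

Lemma qmulDl x y z : qmul (x + y) z = qmul x z + qmul y z.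
Proof. by congr pair; rewrite /= !mulmxDl addrACA. Qed.

Lemma qmulDr x y z : qmul z (x + y) = qmul z x + qmul z y.
Proof. by congr pair; rewrite /= !mulmxDr addrACA. Qed.

Lemma qmul0l x : qmul 0 x = 0.
Proof. by congr pair; rewrite /= !mul0mx addr0. Qed.

Lemma qmul0r x : qmul x 0 = 0.
Proof. by congr pair; rewrite /= !mulmx0 addr0. Qed.

Lemma qbrDl x y z : qbr (x + y) z = qbr x z + qbr y z.
Proof.
rewrite unlock -big_split; apply: eq_bigr => p _; rewrite -big_split.
apply: eq_bigr => q _.
by rewrite qcompD qmulDl qmulDr scalerDr opprD addrACA.
Qed.

Lemma qbrDr x y z : qbr z (x + y) = qbr z x + qbr z y.
Proof.
rewrite unlock -big_split; apply: eq_bigr => p _; rewrite -big_split.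
apply: eq_bigr => q _.
by rewrite qcompD qmulDl qmulDr scalerDr opprD addrACA.
Qed.

Lemma qbr0l x : qbr 0 x = 0.
Proof. by apply: (addrI (qbr 0 x)); rewrite -qbrDl !addr0. Qed.

Lemma qbr0r x : qbr x 0 = 0.
Proof. by apply: (addrI (qbr x 0)); rewrite -qbrDr !addr0. Qed.

Lemma qbr_homogE p q x y : qhomog p x -> qhomog q y ->
  qbr x y = qmul x y - (-1) ^+ (p && q) *: qmul y x.
Proof.
move=> px qy; rewrite unlock (bigD1 p) //= [X in _ + X]big1 ?addr0; last first.
  move=> p' /negPf p'p; have -> : p' = ~~ p by case: p p' p'p {px} => -[].
  by apply: big1 => q' _; rewrite qcomp_neg // qmul0l qmul0r scaler0 subr0.
rewrite (bigD1 q) //= [X in _ + X]big1 ?addr0; last first.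
  move=> q' /negPf q'q; have -> : q' = ~~ q by case: q q' q'q {qy} => -[].
  by rewrite (qcomp_neg qy) qmul0l qmul0r scaler0 subr0.
by rewrite !qcomp_id.
Qed.

Lemma qhomogB p x y (k : C) : qhomog p x -> qhomog p y -> qhomog p (x - k *: y).
Proof.
by case: x y => [a b] [c d]; case: p => /eqP /= -> /eqP ->; rewrite scaler0 subr0.
Qed.

Lemma qmul_homog p q x y : qhomog p x -> qhomog q y -> qhomog (p (+) q) (qmul x y).
Proof.
case: x y => [a b] [c d]; case: p; case: q => /eqP /= -> /eqP ->;
  by rewrite ?mulmx0 ?mul0mx addr0.
Qed.

Lemma qbr_homog p q x y : qhomog p x -> qhomog q y -> qhomog (p (+) q) (qbr x y).
Proof.
move=> px qy; rewrite (qbr_homogE px qy); apply: qhomogB.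
  exact: qmul_homog.
by rewrite addbC; apply: qmul_homog.
Qed.

Fact qpar_linear : linear (@qpar R N).
Proof. by move=> k x y; congr pair; rewrite /= opprD scalerN. Qed.
HB.instance Definition _ := GRing.isLinear.Build C queer queer _ _ qpar_linear.

Lemma qpar_homogE p x : qhomog p x -> qpar x = (-1) ^+ p *: x.
Proof.
by case: x => a b; case: p => /eqP /= ->; congr pair => /=;
  rewrite ?expr0 ?expr1 ?scaleN1r ?scale1r ?oppr0.
Qed.

Lemma qpar_homog p x : qhomog p x -> qhomog p (qpar x).
Proof. by case: x => a b; case: p => /eqP /= ->; rewrite ?oppr0. Qed.

Lemma qparM x y : qpar (qmul x y) = qmul (qpar x) (qpar y).
Proof. by congr pair; rewrite /= ?mulNmx ?mulmxN ?opprK // opprD. Qed.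

Lemma qparK x : qpar (qpar x) = x.
Proof. by case: x => a b; rewrite /qpar /= opprK. Qed.

Lemma qpar_br p q x y : qhomog p x -> qhomog q y ->
  qpar (qbr x y) = qbr (qpar x) (qpar y).
Proof.
move=> px qy; rewrite (qbr_homogE px qy).
rewrite (qbr_homogE (qpar_homog px) (qpar_homog qy)) -!qparM.
by rewrite raddfB; congr (_ - _); apply: linearZ.
Qed.
End QueerTheory.

Section EnvParity.
Variables (R : realType) (N : nat).
Local Notation C := R[i].
Local Notation queer := (queer R N).
Local Notation env := (env R N).

Fact env_inj_par_linear : linear (@env_inj R N \o @qpar R N).
Proof. by move=> k x y; rewrite /= linearP linearP. Qed.
HB.instance Definition _ :=
  GRing.isLinear.Build C queer env _ (@env_inj R N \o @qpar R N) env_inj_par_linear.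

Fact env_inj_par_br p q x y : qhomog p x -> qhomog q y ->
  (@env_inj R N \o @qpar R N) (qbr x y)
  = (@env_inj R N \o @qpar R N) x * (@env_inj R N \o @qpar R N) y
    - (-1) ^+ (p && q)
      *: ((@env_inj R N \o @qpar R N) y * (@env_inj R N \o @qpar R N) x).
Proof.
move=> px qy; rewrite /comp (qpar_br px qy).
exact: env_inj_br (qpar_homog px) (qpar_homog qy).
Qed.

(* The parity automorphism of U(g), induced by S' |-> - S' on g: it is (-1)^p on
   the elements of parity p, which are therefore its eigenvectors. *)
Definition env_par : env -> env := env_lift (@env_inj R N \o @qpar R N).

HB.instance Definition _ := GRing.isLinear.Build C env env _ env_par
  (env_lift_linear env_inj_par_br).
HB.instance Definition _ := GRing.isMonoidMorphism.Build env env env_par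
  (env_lift_monoid env_inj_par_br).

Lemma env_par_inj x : env_par (env_inj x) = env_inj (qpar x).
Proof. exact: (env_lift_inj env_inj_par_br). Qed.

Lemma env_parK : involutive env_par.
Proof.
apply: (@env_ext _ _ _ (env_par \o env_par) idfun) => x.
by rewrite /= !env_par_inj qparK.
Qed.
End EnvParity.

Lemma half_double (F : numFieldType) (V : lmodType F) (v : V) :
  2^-1 *: (v + v) = v.
Proof.
have -> : v + v = 2 *: v by rewrite scaler_nat mulr2n.
by rewrite scalerA mulVf ?scale1r // pnatr_eq0.
Qed.

Lemma alg_br_sum (K : comNzRingType) (A : algType K) (k : K) (b u0 u1 : A) :
  b * u1 - k *: (u1 * b) + (b * u0 - (-1) ^+ false *: (u0 * b))
  = b * (u0 + u1) - (u0 + k *: u1) * b.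
Proof.
rewrite expr0 scale1r mulrDr mulrDl opprD -scalerAl.
by rewrite addrACA [b * u1 + _]addrC [- _ - _]addrC.
Qed.

Lemma alg_br_D (K : comNzRingType) (A : algType K) (k : K) (u v w : A) :
  (u + v) * w - k *: (w * (u + v))
  = (u * w - k *: (w * u)) + (v * w - k *: (w * v)).
Proof. by rewrite mulrDl mulrDr scalerDr opprD addrACA. Qed.

Section AlgebraIdentities.
Variables (K : comNzRingType) (A : algType K).
Implicit Types (k : K) (b u v w : A).

Lemma alg_br_M b u v w z : b * (u * z) - v * w * b
  = (b * u - v * b) * z + v * (b * z - w * b).
Proof. by rewrite mulrBl mulrBr !mulrA addrA subrK. Qed.

Lemma alg_br_D2 b u v w z : b * (u + v) - (w + z) * b
  = (b * u - w * b) + (b * v - z * b).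
Proof. by rewrite mulrDl mulrDr opprD addrACA. Qed.

Lemma alg_br_Z k b u v : b * (k *: u) - (k *: v) * b = k *: (b * u - v * b).
Proof. by rewrite -scalerAl -scalerAr -scalerBr. Qed.

Lemma alg_mul_diff b u v w : b * u - v * w = b * (u - w) + (b - v) * w.
Proof. by rewrite mulrBr mulrBl addrA subrK. Qed.

Lemma alg_br_sign (e : K) b u v : e * e = 1 ->
  b * u - v * b = e *: ((e *: b) * u - v * (e *: b)).
Proof.
move=> e1; rewrite -scalerAl -scalerAr -scalerBr scalerA e1.
by rewrite scale1r.
Qed.

Lemma alg_gen_swap k b u v : k *: u = k *: v ->
  (b - k%:A) * u = (b * u - v * b) + v * (b - k%:A).
Proof.
move=> kuv; rewrite mulrBl mulrBr addrA subrK mulr_algl mulr_algr.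
by rewrite kuv.
Qed.

Lemma alg_br_const k (e : K) b u :
  b * (u - k%:A) - (e *: u - k%:A) * b = b * u - e *: (u * b).
Proof.
rewrite mulrBr mulrBl mulr_algl mulr_algr scalerAl opprB.
by rewrite addrA subrK.
Qed.
End AlgebraIdentities.

Lemma lmod_compD (K : comNzRingType) (V : lmodType K) (a e : K) (u v x y : V) :
  a *: (u + v + e *: (x + y)) = a *: (u + e *: x) + a *: (v + e *: y).
Proof. by rewrite [e *: (x + y)]scalerDr addrACA scalerDr. Qed.

(* The component of parity p of u *)
HB.lock Definition env_comp (R : realType) (N : nat) (p : bool) (u : env R N) :
  env R N := 2^-1 *: (u + (-1) ^+ p *: env_par u).
Canonical env_comp_unlockable := Unlockable env_comp.unlock.

(* The supercommutator of U(g) *)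
HB.lock Definition env_br (R : realType) (N : nat) (u v : env R N) : env R N :=
  \sum_(p : bool) \sum_(q : bool)
    (env_comp p u * env_comp q v
     - (-1) ^+ (p && q) *: (env_comp q v * env_comp p u)).
Canonical env_br_unlockable := Unlockable env_br.unlock.

Section EnvBracket.
Variables (R : realType) (N : nat).
Local Notation C := R[i].
Local Notation queer := (queer R N).
Local Notation env := (env R N).
Implicit Types (u v w : env).

Definition env_homog (p : bool) u : Prop := env_par u = (-1) ^+ p *: u.

Definition env_par_if (p : bool) u : env := if p then env_par u else u.

Lemma env_injD (x y : queer) : env_inj (x + y) = env_inj x + env_inj y.
Proof. exact: raddfD. Qed.

Lemma env_injZ (k : C) (x : queer) : env_inj (k *: x) = k *: env_inj x.
Proof. exact: linearZ. Qed.

Lemma env_parD u v : env_par (u + v) = env_par u + env_par v.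
Proof. exact: raddfD. Qed.

Lemma env_parZ (k : C) u : env_par (k *: u) = k *: env_par u.
Proof. exact: linearZ. Qed.

Lemma env_parB u v : env_par (u - v) = env_par u - env_par v.
Proof. exact: raddfB. Qed.

Lemma env_parM u v : env_par (u * v) = env_par u * env_par v.
Proof. exact: rmorphM. Qed.

Lemma env_par1 : env_par 1 = 1 :> env.
Proof. exact: rmorph1. Qed.

Lemma env_half u : 2^-1 *: (u + u) = u :> env.
Proof.
exact: half_double.
Qed.

Lemma env_comp_homog p u : env_homog p (env_comp p u).
Proof.
rewrite /env_homog unlock env_parZ env_parD env_parZ env_parK.
rewrite [RHS]scalerA mulrC -scalerA; congr (_ *: _).
by rewrite scalerDr scalerA -signr_addb addbb scale1r addrC.
Qed.

Lemma env_comp_sum u : env_comp false u + env_comp true u = u.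
Proof.
rewrite unlock -scalerDr expr0 expr1 scale1r scaleN1r addrACA subrr addr0.
exact: env_half.
Qed.

Lemma env_comp_diff u : env_comp false u - env_comp true u = env_par u.
Proof.
rewrite unlock -scalerBr expr0 expr1 scale1r scaleN1r opprD opprK addrACA.
by rewrite subrr add0r env_half.
Qed.

Lemma env_comp_inj p (x : queer) : env_comp p (env_inj x) = env_inj (qcomp p x).
Proof.
transitivity (env_inj (2^-1 *: (qcomp p x + qcomp p x))).
  2: by rewrite half_double.
have -> : qcomp p x + qcomp p x = x + (-1) ^+ p *: qpar x.
  case: x => a b; case: p; congr pair => /=;
  by rewrite ?expr0 ?expr1 ?scale1r ?scaleN1r ?addr0 ?subrr ?opprK.
rewrite unlock env_par_inj.
by rewrite env_injZ env_injD env_injZ.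
Qed.

Lemma env_br_homog p (b : queer) u : qhomog p b ->
  env_br (env_inj b) u = env_inj b * u - env_par_if p u * env_inj b.
Proof.
move=> pb; rewrite env_br.unlock (bigD1 p) //= [X in _ + X]big1 ?addr0; last first.
  move=> p' /negPf p'p; have -> : p' = ~~ p by case: p p' p'p {pb} => -[].
  apply: big1 => q' _.
  by rewrite env_comp_inj qcomp_neg // raddf0 mul0r mulr0 scaler0 subr0.
rewrite big_bool /= env_comp_inj qcomp_id // andbT andbF alg_br_sum env_comp_sum.
congr (_ - _ * _); case: p {pb} => /=.
  by rewrite expr1 scaleN1r env_comp_diff.
by rewrite expr0 scale1r env_comp_sum.
Qed.

Lemma env_compE p u : env_comp p u = 2^-1 *: (u + (-1) ^+ p *: env_par u).
Proof. by rewrite unlock. Qed.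

Lemma env_compD p u v : env_comp p (u + v) = env_comp p u + env_comp p v.
Proof. rewrite !env_compE env_parD; exact: lmod_compD. Qed.

Lemma env_brDl u v w : env_br (u + v) w = env_br u w + env_br v w.
Proof.
rewrite env_br.unlock -big_split; apply: eq_bigr => p _; rewrite -big_split.
apply: eq_bigr => q _.
by rewrite env_compD alg_br_D.
Qed.

Lemma env_par_ifM p u v : env_par_if p (u * v) = env_par_if p u * env_par_if p v.
Proof. by case: p => //; apply: rmorphM. Qed.
Lemma env_par_ifD p u v : env_par_if p (u + v) = env_par_if p u + env_par_if p v.
Proof. by case: p => //; apply: raddfD. Qed.
Lemma env_par_ifZ p (k : C) u : env_par_if p (k *: u) = k *: env_par_if p u.
Proof. by case: p => //; apply: linearZ. Qed.
Lemma env_par_if1 p : env_par_if p 1 = 1.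
Proof. by case: p => //; apply: rmorph1. Qed.
Lemma env_par_if_inj p q (x : queer) : qhomog q x ->
  env_par_if p (env_inj x) = (-1) ^+ (p && q) *: env_inj x.
Proof.
move=> qx; case: p => /=; last by rewrite expr0 scale1r.
by rewrite env_par_inj (qpar_homogE qx) env_injZ.
Qed.
End EnvBracket.

Section WAlgebra.
Variables (R : realType) (N : nat).
Local Notation C := R[i].
Local Notation queer := (queer R N).
Local Notation env := (env R N).
Variables (chi : {scalar queer}) (G : int -> {vspace queer}) (l : {vspace queer}).

(* l' *)
Definition iso_perp (x : queer) : Prop :=
  x \in G (-1) /\ forall y, y \in l -> chi (qbr x y) = 0.

(* L + \bigoplus_(i <= -2) G i *)
Definition plus_low (L : queer -> Prop) (x : queer) : Prop :=
  exists u v, [/\ L u, gr_span G (fun i => i <= - 2%:Z) v & x = u + v].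

(* m and m' *)
Definition mset : queer -> Prop := plus_low (fun u => u \in l).
Definition mset' : queer -> Prop := plus_low iso_perp.

Definition Wgen (z : env) : Prop := exists p a,
  [/\ qhomog p a, mset a & z = env_inj a - (chi a)%:A].

Definition Wideal : {pred env} := lideal Wgen.
HB.instance Definition _ := GRing.SubmodClosed.on Wideal.

Definition Wcoset (y : env) : lmodq Wideal := to_lmodq Wideal y.

Definition Winv (y : env) : Prop :=
  forall b, mset' b -> env_br (env_inj b) y \in Wideal.

(* The ad m'-invariants of U(g) / I_l *)
Definition Wpred : {pred lmodq Wideal} :=
  fun w => `[< exists2 y, Winv y & w = Wcoset y >].

Hypotheses (chi_nilp : nilpotent_functional chi).
Hypotheses (G_good : good_grading chi G) (l_iso : isotropic chi G l).

Lemma gr_span_D P x y : gr_span G P x -> gr_span G P y -> gr_span G P (x + y).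
Proof.
move=> [s sP ->] [t tP ->]; exists (s ++ t); last by rewrite big_cat.
by move=> z; rewrite mem_cat => /orP[/sP|/tP].
Qed.

Lemma gr_span_mem (P : pred int) j x : P j -> x \in G j -> gr_span G P x.
Proof.
move=> Pj xj; exists [:: (j, x)]; last by rewrite big_seq1.
by move=> t /[!inE] /eqP ->.
Qed.

Lemma gr_span0 P : gr_span G P 0.
Proof. by exists [::]; rewrite ?big_nil. Qed.

Lemma gr_span_sub (P Q : pred int) x :
  (forall j, P j -> Q j) -> gr_span G P x -> gr_span G Q x.
Proof. by move=> PQ [s sP ->]; exists s => // t /sP[/PQ]. Qed.

Lemma gr_span_comp (P : pred int) p x : gr_span G P x -> gr_span G P (qcomp p x).
Proof.
move=> [s sP ->]; exists [seq (t.1, qcomp p t.2) | t <- s].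
  move=> _ /mapP[t /sP[Pt tG] ->]; split=> //=.
  by case: G_good => -[_ _ Gc _] _ _ _; apply: Gc.
rewrite big_map (big_morph (qcomp p) (qcompD p) (_ : _ = 0)) //.
by case: p.
Qed.

Lemma gr_span_br (P Q S : pred int) x y :
  (forall j k, P j -> Q k -> S (j + k)) ->
  gr_span G P x -> gr_span G Q y -> gr_span G S (qbr x y).
Proof.
case: G_good => -[_ _ _ Gbr] _ _ _ PQS [s sP ->] [t tQ ->].
rewrite (big_morph (fun x => qbr x _) (fun u v => qbrDl u v _) (qbr0l _)).
rewrite big_seq; elim/big_rec: _ => [|a z /sP[Pa aG] IH]; first exact: gr_span0.
apply: gr_span_D IH.
rewrite (big_morph (qbr _) (fun u v => qbrDr u v _) (qbr0r _)).
rewrite big_seq; elim/big_rec: _ => [|b w /tQ[Qb bG] IH]; first exact: gr_span0.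
by apply: gr_span_D IH; apply: (gr_span_mem (PQS _ _ Pa Qb)); apply: Gbr.
Qed.

Lemma chi_gr_span (P : pred int) x :
  (forall j, P j -> j != - 2%:Z) -> gr_span G P x -> chi x = 0.
Proof.
move=> P2 [s sP ->]; rewrite raddf_sum big_seq big1 // => t /sP[/P2 t2 tG].
by case: G_good => _ _ chiG _; apply: chiG tG.
Qed.

Lemma chi_odd x : qhomog true x -> chi x = 0.
Proof. by case: chi_nilp => + _; apply. Qed.

Lemma chi_comp p x : chi x = 0 -> chi (qcomp p x) = 0.
Proof.
have chi1 y : chi (qcomp true y) = 0 by apply: chi_odd (qcomp_homog _ _).
move=> x0; case: p => //; move: x0.
by rewrite -{1}[x]qcomp_sum raddfD /= chi1 addr0.
Qed.

Lemma chi_qbr_comp p x y : chi (qbr (qcomp p x) y) = chi (qbr x (qcomp p y)).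
Proof.
have chi1 q a b : chi (qbr (qcomp q a) (qcomp (~~ q) b)) = 0.
  apply: chi_odd.
  have := qbr_homog (qcomp_homog q a) (qcomp_homog (~~ q) b).
  by case: q.
have sumN (z : queer) : qcomp p z + qcomp (~~ p) z = z.
  by case: (p); rewrite /= ?qcomp_sum // addrC qcomp_sum.
have chiD (a b : queer) : chi (a + b) = chi a + chi b by apply: raddfD.
transitivity (chi (qbr (qcomp p x) (qcomp p y))).
  by rewrite -[in LHS](sumN y) qbrDr chiD (chi1 p x y) addr0.
rewrite -[in RHS](sumN x) qbrDl chiD.
by have := chi1 (~~ p) x y; rewrite negbK => ->; rewrite addr0.
Qed.

Lemma iso_perp_mem x : x \in l -> iso_perp x.
Proof.
case: l_iso => /subvP lG _ l0 xl; split; first exact: lG.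
by move=> y yl; apply: l0.
Qed.

Lemma iso_perp_comp p x : iso_perp x -> iso_perp (qcomp p x).
Proof.
case: G_good => -[_ _ Gc _] _ _ _ [xG x0]; split; first exact: Gc.
move=> y yl; rewrite chi_qbr_comp; apply: x0.
by case: l_iso => _ lc _; apply: lc.
Qed.

Lemma plus_low_comp (L : queer -> Prop) p x :
  (forall y, L y -> L (qcomp p y)) -> plus_low L x -> plus_low L (qcomp p x).
Proof.
move=> Lc [u [v [Lu vG ->]]]; exists (qcomp p u), (qcomp p v).
by split; [apply: Lc|apply: gr_span_comp|rewrite qcompD].
Qed.

Lemma mset_comp p x : mset x -> mset (qcomp p x).
Proof. by apply: plus_low_comp => y yl; case: l_iso => _ lc _; apply: lc. Qed.

Lemma mset'_comp p x : mset' x -> mset' (qcomp p x).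
Proof. by apply: plus_low_comp => y; apply: iso_perp_comp. Qed.

Lemma mset_sub x : mset x -> mset' x.
Proof.
move=> [u [v [ul vG ->]]]; exists u, v; split=> //; exact: iso_perp_mem.
Qed.

Lemma mset_low x : gr_span G (fun i => i <= - 2%:Z) x -> mset x.
Proof. by move=> xG; exists 0, x; split; rewrite ?mem0v ?add0r. Qed.

Lemma mset_br b a : mset' b -> mset a -> mset (qbr b a) /\ chi (qbr b a) = 0.
Proof.
move=> [u [v [[uG u0] vG ->]]] [u' [v' [u'l v'G ->]]].
have u'G : u' \in G (-1) by case: l_iso => /subvP lG _ _; apply: lG.
have low1 (w : queer) : w \in G (-1) -> gr_span G (fun i => i <= -1) w.
  exact: gr_span_mem.
have lowE : gr_span G (fun i => i <= - 3%:Z) (qbr u v' + qbr v (u' + v')).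
  apply: gr_span_D.
    by apply: gr_span_br (low1 _ uG) v'G => j k j1 k2; apply: (lerD j1 k2).
  have u'v' : gr_span G (fun i => i <= -1) (u' + v').
    apply: gr_span_D; first exact: low1.
    by apply: gr_span_sub v'G => j j2; apply: le_trans j2 _.
  by apply: gr_span_br vG u'v' => j k j2 k1; apply: (lerD j2 k1).
have -> : qbr (u + v) (u' + v') = qbr u u' + (qbr u v' + qbr v (u' + v')).
  by rewrite qbrDl qbrDr addrA.
split; last first.
  rewrite raddfD /= u0 // add0r.
  by apply: chi_gr_span lowE => j; apply: contraTneq => ->.
apply/mset_low/gr_span_D.
  case: G_good => -[_ _ _ Gbr] _ _ _.
  by apply: (@gr_span_mem _ (-1 - 1)) => //; apply: Gbr.
by apply: gr_span_sub lowE => j j3; apply: le_trans j3 _.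
Qed.

Lemma Wideal_Ml u z : z \in Wideal -> u * z \in Wideal.
Proof. exact: lidealMl. Qed.

Lemma Wideal_gen p a : qhomog p a -> mset a -> env_inj a - (chi a)%:A \in Wideal.
Proof. by move=> pa ma; apply: lideal_gen; exists p, a. Qed.

Lemma Wideal_inj a : mset a -> chi a = 0 -> env_inj a \in Wideal.
Proof.
move=> ma a0.
have aI p : env_inj (qcomp p a) \in Wideal.
  have := Wideal_gen (qcomp_homog p a) (mset_comp p ma).
  by rewrite (chi_comp p a0) scale0r subr0.
by rewrite -[a]qcomp_sum env_injD rpredD.
Qed.

Lemma WinvP y : Winv y <-> forall p b, qhomog p b -> mset' b ->
  env_inj b * y - env_par_if p y * env_inj b \in Wideal.
Proof.
split=> [Wy p b pb mb|Wy b mb]; first by rewrite -env_br_homog //; apply: Wy.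
rewrite -[b]qcomp_sum env_injD env_brDl rpredD //;
  rewrite (env_br_homog _ (qcomp_homog _ _));
  exact: Wy (qcomp_homog _ _) (mset'_comp _ mb).
Qed.

Lemma Winv_Mr y z : Winv y -> z \in Wideal -> z * y \in Wideal.
Proof.
move=> /WinvP Wy /asboolP[s sG ->]; rewrite mulr_suml big_seq.
apply: rpred_sum => t /sG [p [a [pa ma ->]]]; rewrite -mulrA; apply: Wideal_Ml.
have -> : (env_inj a - (chi a)%:A) * y
  = (env_inj a * y - env_par_if p y * env_inj a)
    + env_par_if p y * (env_inj a - (chi a)%:A).
  apply: alg_gen_swap.
  case: p pa {Wy} => [pa|_]; last exact: erefl.
  by rewrite (chi_odd pa) !scale0r.
apply: rpredD; first exact: Wy (mset_sub ma).
exact/Wideal_Ml/(Wideal_gen pa).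
Qed.

Lemma Winv_M y z : Winv y -> Winv z -> Winv (y * z).
Proof.
move=> Wy Wz; apply/WinvP => p b pb mb; rewrite env_par_ifM.
move: (proj1 (WinvP y) Wy p b pb mb) (proj1 (WinvP z) Wz p b pb mb).
set b' := env_inj b; set y' := env_par_if p y; set z' := env_par_if p z => yI zI.
have -> : b' * (y * z) - y' * z' * b' = (b' * y - y' * b') * z + y' * (b' * z - z' * b').
  exact: alg_br_M.
by apply: rpredD; [apply: Winv_Mr|apply: Wideal_Ml].
Qed.

Lemma Winv_1 : Winv 1.
Proof. by apply/WinvP => p b _ _; rewrite env_par_if1 mulr1 mul1r subrr; apply: rpred0. Qed.

Lemma Winv_0 : Winv 0.
Proof.
apply/WinvP => p b _ _; rewrite -[in env_par_if p _](scale0r 1) env_par_ifZ.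
by rewrite scale0r mulr0 mul0r subrr rpred0.
Qed.

Lemma Winv_D y z : Winv y -> Winv z -> Winv (y + z).
Proof.
move=> /WinvP Wy /WinvP Wz; apply/WinvP => p b pb mb.
rewrite env_par_ifD alg_br_D2; apply: rpredD; [exact: Wy|exact: Wz].
Qed.

Lemma Winv_Z (k : C) y : Winv y -> Winv (k *: y).
Proof.
move=> /WinvP Wy; apply/WinvP => p b pb mb.
by rewrite env_par_ifZ alg_br_Z; apply/rpredZ/Wy.
Qed.

Lemma Wideal_Winv y : y \in Wideal -> Winv y.
Proof.
move=> /asboolP[s sG ->]; rewrite big_seq; elim/big_rec: _ => [|t z /sG tG].
  exact: Winv_0.
apply: Winv_D; case: tG => q [a [qa ma ->]]; apply/WinvP => p b pb mb.
rewrite env_par_ifM; set b' := env_inj b; set g := env_inj a - _; set u := t.1.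
set u' := env_par_if p u; set g' := env_par_if p g.
have -> : b' * (u * g) - u' * g' * b' = (b' * u - u' * b') * g + u' * (b' * g - g' * b').
  exact: alg_br_M.
apply: rpredD; apply: Wideal_Ml; first exact: (Wideal_gen qa).
have [mba cba] := mset_br mb ma.
suff -> : b' * g - g' * b' = env_inj (qbr b a) by apply: Wideal_inj.
rewrite (env_inj_br pb qa) /g'.
have -> : env_par_if p g = (-1) ^+ (p && q) *: env_inj a - (chi a)%:A.
  rewrite /g -scaleN1r env_par_ifD env_par_ifZ env_par_ifZ env_par_if1 scaleN1r.
  by rewrite (env_par_if_inj p qa).
exact: alg_br_const.
Qed.

Lemma Wcoset_eq y z : Wcoset y = Wcoset z <-> y - z \in Wideal.
Proof. exact: to_lmodq_eq. Qed.

Lemma Winv_eq y z : Wcoset y = Wcoset z -> Winv y -> Winv z.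
Proof.
move=> /esym/Wcoset_eq/Wideal_Winv zy Wy.
by rewrite -[z](subrK y); apply: Winv_D.
Qed.

Fact Wpred_submod : subsemimod_closed Wpred.
Proof.
split; first split.
- by apply/asboolP; exists 0; [apply: Winv_0|rewrite /Wcoset raddf0].
- move=> _ _ /asboolP[y Wy ->] /asboolP[z Wz ->]; apply/asboolP.
  by exists (y + z); [apply: Winv_D|rewrite /Wcoset raddfD].
- move=> k _ /asboolP[y Wy ->]; apply/asboolP.
  by exists (k *: y); [apply: Winv_Z|apply/esym; apply: linearZ].
Qed.

(* The three proofs are what makes the product of cosets well defined
   ([Wcoset_mul]) and closed ([Winv_M]).  W is only declared as a [pzRingType]
   and an [lmodType]: [algType] would require 1 != 0 in W; compatibility of
   the two structures is [Wscale_Al] and [Wscale_Ar]. *)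
Definition Walg of nilpotent_functional chi & good_grading chi G
  & isotropic chi G l : Type := {w : lmodq Wideal | w \in Wpred}.

Local Notation W := (Walg chi_nilp G_good l_iso).
HB.instance Definition _ := Choice.on W.
HB.instance Definition _ := SubType.on W.
HB.instance Definition _ :=
  GRing.SubChoice_isSubLmodule.Build C (lmodq Wideal) Wpred W Wpred_submod.

(* The Z/2-grading of W inherited from U(g) *)
Definition Whomog (p : bool) (w : W) : Prop :=
  exists2 y, env_homog p y & val w = Wcoset y.

Fact Wclass_subproof y : Winv y -> Wcoset y \in Wpred.
Proof. by move=> Wy; apply/asboolP; exists y. Qed.

Definition Wclass y (Wy : Winv y) : W := Sub (Wcoset y) (Wclass_subproof Wy).

Definition Wrepr (w : W) : env := repr (val w).

Lemma Wcoset_repr w : Wcoset (Wrepr w) = val w.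
Proof. exact: to_lmodqK. Qed.

Lemma Wrepr_inv w : Winv (Wrepr w).
Proof.
have /asboolP[y Wy wy] := valP w.
by apply: Winv_eq Wy; rewrite Wcoset_repr.
Qed.

Definition Wone : W := Wclass Winv_1.
Definition Wmul (v w : W) : W := Wclass (Winv_M (Wrepr_inv v) (Wrepr_inv w)).

Lemma Wcoset_mul y y' z z' : Winv z ->
  Wcoset y = Wcoset y' -> Wcoset z = Wcoset z' -> Wcoset (y' * z') = Wcoset (y * z).
Proof.
move=> Wz /esym/Wcoset_eq yI /esym/Wcoset_eq zI; apply/Wcoset_eq.
rewrite alg_mul_diff; apply: rpredD; first exact: Wideal_Ml.
exact: Winv_Mr.
Qed.

Lemma val_Wmul y z v w : Winv z -> val v = Wcoset y -> val w = Wcoset z ->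
  val (Wmul v w) = Wcoset (y * z).
Proof. by move=> Wz vy wz; apply: Wcoset_mul => //; rewrite Wcoset_repr. Qed.

Lemma Wmul_val v w : val (Wmul v w) = Wcoset (Wrepr v * Wrepr w).
Proof. by []. Qed.

Lemma WcosetD y z : Wcoset (y + z) = Wcoset y + Wcoset z.
Proof. exact: raddfD. Qed.

Lemma WcosetZ k y : Wcoset (k *: y) = k *: Wcoset y.
Proof. exact: linearZ. Qed.

Fact WmulA : associative Wmul.
Proof.
move=> u v w; apply: val_inj.
rewrite (val_Wmul (Winv_M (Wrepr_inv v) (Wrepr_inv w)) (esym (Wcoset_repr u)) (Wmul_val v w)).
rewrite (val_Wmul (Wrepr_inv w) (Wmul_val u v) (esym (Wcoset_repr w))).
by rewrite mulrA.
Qed.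

Fact Wmul1 : left_id Wone Wmul.
Proof.
move=> w; apply: val_inj.
rewrite (@val_Wmul 1 (Wrepr w)) ?mul1r ?Wcoset_repr //; exact: Wrepr_inv.
Qed.

Fact Wmulr1 : right_id Wone Wmul.
Proof.
move=> w; apply: val_inj.
rewrite (@val_Wmul (Wrepr w) 1) ?mulr1 ?Wcoset_repr //; exact: Winv_1.
Qed.

Lemma Wrepr_addE v w : val (v + w) = Wcoset (Wrepr v + Wrepr w).
Proof. by rewrite WcosetD !Wcoset_repr. Qed.

Lemma Wrepr_scaleE k w : val (k *: w) = Wcoset (k *: Wrepr w).
Proof. by rewrite WcosetZ Wcoset_repr. Qed.

Fact WmulDl : left_distributive Wmul +%R.
Proof.
move=> u v w; apply: val_inj.
rewrite (val_Wmul (Wrepr_inv w) (Wrepr_addE u v) (esym (Wcoset_repr w))).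
by rewrite mulrDl WcosetD.
Qed.

Fact WmulDr : right_distributive Wmul +%R.
Proof.
move=> u v w; apply: val_inj.
rewrite (val_Wmul (Winv_D (Wrepr_inv v) (Wrepr_inv w)) (esym (Wcoset_repr u))
  (Wrepr_addE v w)).
by rewrite mulrDr WcosetD.
Qed.

HB.instance Definition _ := GRing.Zmodule_isPzRing.Build W
  WmulA Wmul1 Wmulr1 WmulDl WmulDr.

Lemma Wclass1 : 1 = Wclass Winv_1 :> W.
Proof. exact: erefl. Qed.

Lemma WclassM y z (Wy : Winv y) (Wz : Winv z) :
  Wclass Wy * Wclass Wz = Wclass (Winv_M Wy Wz).
Proof. by apply: val_inj; apply: val_Wmul. Qed.

Lemma Wscale_Al (k : C) (v w : W) : k *: (v * w) = (k *: v) * w.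
Proof.
apply: val_inj.
rewrite [RHS](val_Wmul (Wrepr_inv w) (Wrepr_scaleE k v) (esym (Wcoset_repr w))).
by rewrite -scalerAl WcosetZ.
Qed.

Lemma Wscale_Ar (k : C) (v w : W) : k *: (v * w) = v * (k *: w).
Proof.
apply: val_inj.
rewrite [RHS](val_Wmul (Winv_Z k (Wrepr_inv w)) (esym (Wcoset_repr v))
  (Wrepr_scaleE k w)).
by rewrite -scalerAr WcosetZ.
Qed.
Lemma Wideal_par y : y \in Wideal -> env_par y \in Wideal.
Proof.
move=> /asboolP[s sG ->]; rewrite big_seq.
rewrite (big_morph (@env_par R N) (@env_parD R N) (raddf0 _)).
apply: rpred_sum => t /sG [p [a [pa ma ->]]].
have -> : env_par (t.1 * (env_inj a - (chi a)%:A))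
  = env_par t.1 * env_par (env_inj a - (chi a)%:A) by apply: env_parM.
apply: Wideal_Ml.
have -> : env_par (env_inj a - (chi a)%:A) = (-1) ^+ p *: (env_inj a - (chi a)%:A).
  rewrite env_parB env_parZ env_par1 env_par_inj (qpar_homogE pa) env_injZ.
  rewrite [RHS]scalerBr.
  case: p pa => [pa|_]; first by rewrite (chi_odd pa) scale0r scaler0.
  by rewrite expr0 (scale1r (_ *: 1)).
exact: rpredZ (Wideal_gen pa ma).
Qed.

Lemma Winv_par y : Winv y -> Winv (env_par y).
Proof.
move=> /WinvP Wy; apply/WinvP => p b pb mb.
have -> : env_inj b * env_par y - env_par_if p (env_par y) * env_inj b
  = (-1) ^+ p *: env_par (env_inj b * y - env_par_if p y * env_inj b).
  have -> : env_par (env_inj b * y - env_par_if p y * env_inj b)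
    = env_par (env_inj b) * env_par y
      - env_par (env_par_if p y) * env_par (env_inj b).
    by rewrite env_parB !env_parM.
  have -> : env_par_if p (env_par y) = env_par (env_par_if p y) by case: (p).
  rewrite env_par_inj (qpar_homogE pb) env_injZ; apply: alg_br_sign.
  by rewrite -signr_addb addbb.
by apply/rpredZ/Wideal_par/Wy.
Qed.

Lemma Whomog_decomp (w : W) :
  exists w0 w1, [/\ Whomog false w0, Whomog true w1 & w = w0 + w1].
Proof.
have Wc p : Winv (env_comp p (Wrepr w)).
  rewrite env_compE; apply/Winv_Z/Winv_D; first exact: Wrepr_inv.
  exact/Winv_Z/Winv_par/Wrepr_inv.
exists (Wclass (Wc false)), (Wclass (Wc true)); split.
- by exists (env_comp false (Wrepr w)); first exact: env_comp_homog.
- by exists (env_comp true (Wrepr w)); first exact: env_comp_homog.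
by apply: val_inj; rewrite -Wcoset_repr -{1}(env_comp_sum (Wrepr w)) WcosetD.
Qed.
End WAlgebra.

(* Main.v *)
Require Import Defs.
From HB Require Import structures.
From mathcomp Require Import all_boot all_order all_algebra.
From mathcomp Require Import finmap boolp reals complex monalg.

Import Order.TTheory GRing.Theory Num.Theory.
Local Open Scope ring_scope.

Set Implicit Arguments.
Unset Strict Implicit.
Unset Printing Implicit Defensive.

(** Write I_l for the left ideal attached to an isotropic l.  For k contained
    in l one has I_k <= I_l and m'_l <= m'_k, so the identity of U(g) induces a
    morphism of superalgebras W_k -> W_l.  All these algebras are compared with
    the one of the zero subspace: once W_0 -> W_l is known to be bijective for
    every l, the isomorphism W_l1 -> W_l2 sends a coset to the class modulo
    I_l2 of its unique m'_0-invariant representative modulo I_0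
    ([Winv_compare], [Wmap]).

    Bijectivity is proved by induction on dim l, cutting l down by one
    dimension.  Pick v in l and w in g_(-1) homogeneous of the same parity with
    <w, v> = 1, which is possible because the form on g_(-1) is nondegenerate
    ([pairing_dual]), and let k be the kernel of <w, .> on l, so that
    l = k + C v and m'_k = m'_l + C w.  On M = U(g) / I_k let D = ad w and let
    X be the right multiplication by v, which is well defined since v lies in
    m'_k.  Then U(g) / I_l = M / X M, and since [w, v] acts on the right of M
    by the scalar chi([w, v]) = 1,

      D (X y) = X (D y) + y^(p),

    where y^(p) is y, or its image under the parity automorphism when w and v
    are odd ([ad_mulr_comm]).  The behaviour of ker D follows from this relation.

    - Even case: D and X generate a Weyl algebra and D is locally nilpotent,
      because the grading is finite.  Hence ker D meets X M trivially and maps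
      onto M / X M ([weyl_inj], [weyl_lift]).
    - Odd case: X^2 = 0 on M, because [v, v] acts by chi([v, v]) = 0.  Again
      ker D meets X M trivially; moreover, if y is m'_l-invariant modulo X M,
      the parity conjugate of D (X y) is congruent to y modulo X M and lies in
      ker D, since D^2 = (1/2) ad [w, w] and [w, w] is in m'_l
      ([step_inj_odd], [step_lift_odd]).

    Finally, let y be in ker D and m'_l-invariant modulo X M, and let b be in
    m'_l.  Then ad b y lies in X M, and D kills it as soon as
    ad [w, b] y = 0, so that ad b y = 0 in M ([ad_descent]).  As [w, b] has
    smaller degree than b, induction on the degree shows that y is invariant
    under all of m'_l, hence under m'_k = m'_l + C w ([lift_inv]). *)

(** * Weyl pairs: [d, x] = 1 with d locally nilpotent *)

Section IterLinear.
Variables (K : pzRingType) (V : lmodType K) (f : {linear V -> V}).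

Lemma iter_linear n k u v :
  iter n f (k *: u + v) = k *: iter n f u + iter n f v.
Proof. by elim: n => //= n ->; rewrite linearP. Qed.

Lemma iter_linearD n u v : iter n f (u + v) = iter n f u + iter n f v.
Proof. by elim: n => //= n ->; rewrite raddfD. Qed.

Lemma iter_linear0 n : iter n f 0 = 0.
Proof. by elim: n => //= n ->; rewrite raddf0. Qed.

Lemma iter_linear_le n m u : (n <= m)%N -> iter n f u = 0 -> iter m f u = 0.
Proof. by move=> /subnK <- u0; rewrite iterD u0 iter_linear0. Qed.
End IterLinear.

Section WeylPair.
Variables (K : numFieldType) (M : lmodType K) (d x : {linear M -> M}).
Hypothesis dx : forall y, d (x y) = x (d y) + y.

Lemma weyl_iter n y : iter n.+1 d (x y) = x (iter n.+1 d y) + iter n d y *+ n.+1.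
Proof.
elim: n => [|n IH]; first by rewrite /= dx.
by rewrite iterS IH raddfD raddfMn /= dx -addrA -mulrS.
Qed.

(** From d (x z) = 0 and d^(n+1) z = 0, the commutation rule of d^(n+1) with x
    leaves (n+1) d^n z = 0: the order of nilpotency of z drops down to zero. *)
Lemma weyl_inj n z : iter n d z = 0 -> d (x z) = 0 -> z = 0.
Proof.
move=> + dxz; elim: n => // n IH dnz; apply: IH.
have /eqP : iter n.+1 d (x z) = 0.
  by rewrite iterSr dxz iter_linear0.
rewrite weyl_iter dnz raddf0 add0r -scaler_nat scaler_eq0 pnatr_eq0 /=.
by move/eqP.
Qed.

(** If d^(n+1) y = 0, correcting y by - x (d y) / n lowers the exponent, since
    d^n (x (d y)) = x (d^(n+1) y) + n d^n y. *)
Lemma weyl_lift n y : iter n d y = 0 -> exists z, d (y + x z) = 0.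
Proof.
case: n => [/= ->|n]; first by exists 0; rewrite raddf0 addr0 raddf0.
elim: n y => [|n IH] y dny; first by exists 0; rewrite raddf0 addr0.
pose c : K := - n.+1%:R^-1.
have [|z dz] := IH (y + x (c *: d y)).
  rewrite linearZ addrC iter_linear weyl_iter -!iterSr dny raddf0 add0r.
  by rewrite -scaler_nat scalerA mulNr mulVf ?pnatr_eq0 // scaleN1r addNr.
by exists (c *: d y + z); rewrite (raddfD x) addrA.
Qed.
End WeylPair.

Section QuotientMap.
Variables (K : comNzRingType) (V : lmodType K) (I : submodClosed V).
Variable f : {linear V -> V}.

(** The stability of I is an argument so that the linear structure can be
    inferred from the map. *)
Definition lmodq_map of forall y, y \in I -> f y \in I :=
  fun w : lmodq I => to_lmodq I (f (repr w)).

Hypothesis fI : forall y, y \in I -> f y \in I.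
Local Notation qmap := (lmodq_map fI).

Lemma lmodq_mapE y : qmap (to_lmodq I y) = to_lmodq I (f y).
Proof.
by apply/to_lmodq_eq; rewrite -raddfB; apply/fI/to_lmodq_eq; rewrite to_lmodqK.
Qed.

Fact lmodq_map_linear : linear qmap.
Proof.
move=> a u v; rewrite -[u]to_lmodqK -[v]to_lmodqK -linearP !lmodq_mapE.
by rewrite !linearP.
Qed.
HB.instance Definition _ :=
  GRing.isLinear.Build K (lmodq I) (lmodq I) _ qmap lmodq_map_linear.
End QuotientMap.

Section WeylPairMod.
Variables (K : numFieldType) (V : lmodType K) (I : submodClosed V).
Variables (d x : {linear V -> V}).
Hypotheses (dI : forall y, y \in I -> d y \in I)
  (xI : forall y, y \in I -> x y \in I)
  (dx : forall y, d (x y) - (x (d y) + y) \in I)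
  (d_nil : forall y, exists n, iter n d y = 0).

Let d' : {linear lmodq I -> lmodq I} := lmodq_map dI.
Let x' : {linear lmodq I -> lmodq I} := lmodq_map xI.

Let d'x' w : d' (x' w) = x' (d' w) + w.
Proof.
rewrite -[w]to_lmodqK /d' /x' /= !lmodq_mapE -raddfD; apply/to_lmodq_eq/dx.
Qed.

Let d'_nil y : exists n, iter n d' (to_lmodq I y) = 0.
Proof.
have [n dn] := d_nil y; exists n.
have -> m : iter m d' (to_lmodq I y) = to_lmodq I (iter m d y).
  by elim: m => //= m ->; rewrite lmodq_mapE.
by rewrite dn raddf0.
Qed.

Let mem0 y : to_lmodq I y = 0 <-> y \in I.
Proof. by rewrite -[0](raddf0 (to_lmodq I)) to_lmodq_eq subr0. Qed.

Lemma weyl_mod_inj z : d (x z) \in I -> z \in I.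
Proof.
move=> dxz; apply/mem0; have [n dn] := d'_nil z.
apply: (weyl_inj d'x' dn); rewrite /= !lmodq_mapE; exact/mem0.
Qed.

Lemma weyl_mod_lift y : exists z, d (y + x z) \in I.
Proof.
have [n /(weyl_lift d'x')[w dw]] := d'_nil y; exists (repr w); apply/mem0.
by rewrite -(lmodq_mapE dI) (raddfD (to_lmodq I)) /= -(lmodq_mapE xI) to_lmodqK.
Qed.
End WeylPairMod.

(** * Identities in q(N) and in its enveloping algebra *)

Section FreeAlgebraSpan.
Variables (K : comNzRingType) (I : choiceType).

(** A spanning statement, from which induction principles on the free algebra
    and its quotients follow. *)
Lemma freealg_span (x : freealg K I) :
  x = \sum_(m <- msupp x) x@_m *: \prod_(i <- (m : seq I)) freegen K i.
Proof.
have genE (m : {fmonom I}) : << m >> = \prod_(i <- (m : seq I)) freegen K i.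
  case: m => s; elim: s => [|i s IH]; first by rewrite big_nil -fmoneE.
  rewrite big_cons /= in IH *; rewrite -IH unlock.
  rewrite [RHS]fgmulUU mulr1; congr << _ *g _ >>.
  by rewrite fmuE /mmul /= fmmulE.
rewrite [LHS]monalgE; apply: eq_bigr => m _; rewrite -genE.
by apply/malgP => m'; rewrite mcoeffZ !mcoeffU mulrnAr mulr1.
Qed.
End FreeAlgebraSpan.

Lemma lmod_sign_comm (K : comNzRingType) (V : lmodType K) (k s : K) (u v : V) :
  k *: u - s *: (k *: v) = k *: (u - s *: v).
Proof. by rewrite scalerBr !scalerA mulrC. Qed.

Section QueerBracket.
Variables (R : realType) (N : nat).
Local Notation C := R[i].
Local Notation queer := (queer R N).
Implicit Types (x y : queer) (p q : bool) (k : C).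

Lemma qcompZ p k x : qcomp p (k *: x) = k *: qcomp p x.
Proof. by case: p; congr pair; rewrite /= ?scaler0. Qed.

Lemma qmulZl k x y : qmul (k *: x) y = k *: qmul x y.
Proof. by congr pair; rewrite /= -!scalemxAl scalerDr. Qed.

Lemma qmulZr k x y : qmul x (k *: y) = k *: qmul x y.
Proof. by congr pair; rewrite /= -!scalemxAr scalerDr. Qed.

Lemma qbrZr k x y : qbr x (k *: y) = k *: qbr x y.
Proof.
rewrite unlock scaler_sumr; apply: eq_bigr => p _.
rewrite scaler_sumr; apply: eq_bigr => q _.
rewrite qcompZ qmulZl qmulZr.
exact: lmod_sign_comm.
Qed.

Lemma qbrZl k x y : qbr (k *: x) y = k *: qbr x y.
Proof.
rewrite unlock scaler_sumr; apply: eq_bigr => p _.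
rewrite scaler_sumr; apply: eq_bigr => q _.
rewrite qcompZ qmulZl qmulZr.
exact: lmod_sign_comm.
Qed.

Fact qbr_linear x : linear (qbr x).
Proof. by move=> k y z; rewrite qbrDr qbrZr. Qed.
HB.instance Definition _ x :=
  GRing.isLinear.Build C queer queer _ (qbr x) (qbr_linear x).

Lemma qbr_anti p q x y : qhomog p x -> qhomog q y ->
  qbr y x = - ((-1) ^+ (p && q) *: qbr x y).
Proof.
move=> px qy; rewrite (qbr_homogE px qy) (qbr_homogE qy px) andbC.
by rewrite scalerBr scalerA -signr_addb addbb scale1r opprB.
Qed.
End QueerBracket.

(** Moves b across the generator a - c at the cost of a superbracket, where e is
    the sign attached to a and b and c the value of chi at a: e c = c because
    e = -1 only for odd a, where chi vanishes. *)
Lemma alg_gen_swapr (K : comNzRingType) (A : algType K) (e c : K) (a b : A) :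
  e * e = 1 -> e * c = c ->
  (a - c%:A) * b = e *: (b * (a - c%:A)) - e *: (b * a - e *: (a * b)).
Proof.
move=> e1 ec; rewrite mulrBl mulrBr mulr_algl mulr_algr !scalerBr !scalerA e1 ec.
by rewrite scale1r opprB [RHS]addrC subrKA.
Qed.

(** Trades the generator a - b for the generator a - c v - b. *)
Lemma alg_split_gen (K : comNzRingType) (A : algType K) (c : K) (a b t v y z : A) :
  t * (a - b) + y - (c *: t + z) * v = t * (a - c *: v - b) + (y - z * v).
Proof.
rewrite [a - _ - b]addrAC [in RHS]mulrBr -scalerAr mulrDl -scalerAl.
by rewrite opprD addrACA.
Qed.

(** The super Jacobi identity for the operators b y - y' b, with the images of y
    under the powers of the parity automorphism as free variables: yp, yq, ypq
    are y twisted by the parities of a, of b, and of both, and s is the sign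
    attached to a and b. *)
Lemma alg_jacobi (K : comNzRingType) (A : algType K) (a b y yp yq ypq : A) (s : K) :
  s * s = 1 ->
  a * (b * y - yq * b) - (s *: b * yp - ypq * (s *: b)) * a
  = s *: (b * (a * y - yp * a) - (s *: a * yq - ypq * (s *: a)) * b)
    + ((a * b - s *: (b * a)) * y - ypq * (a * b - s *: (b * a))).
Proof.
move=> s1; rewrite !mulrBr !mulrBl !mulrA -!scalerAl !scalerBr -!scalerAr.
rewrite -!scalerAl !scalerA s1 !scale1r !mulrA.
set t1 := a * b * y; set t2 := a * yq * b; set t3 := s *: (b * yp * a).
set t4 := s *: (ypq * b * a); set t5 := s *: (b * a * y); set t6 := ypq * a * b.
rewrite !opprB [RHS]addrACA [X in _ = X + _]addrC subrKA.
rewrite [t6 - t2 + _]addrC subrKA addrACA [RHS]addrACA.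
by congr (_ + _); apply: addrC.
Qed.

(** For b homogeneous of parity p this is the supercommutator [env_br] with b.
    Carrying the parity as an argument makes the operator linear in y and in b
    with no homogeneity condition. *)
Definition env_ad (R : realType) (N : nat) (p : bool) (b : queer R N)
    (y : env R N) : env R N :=
  env_inj b * y - env_par_if p y * env_inj b.

Section Env.
Variables (R : realType) (N : nat).
Local Notation C := R[i].
Local Notation queer := (queer R N).
Local Notation env := (env R N).
Implicit Types (x y z : queer) (p q : bool) (k : C) (u v : env).

Lemma env_ind (P : env -> Prop) :
    P 1 -> (forall x u, P u -> P (env_inj x * u)) ->
    (forall k u v, P u -> P v -> P (k *: u + v)) ->
  forall u, P u.
Proof.
move=> P1 Pinj Plin u; rewrite -[u]to_envK (freealg_span (repr u)) raddf_sum.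
have P0 : P 0 by have := Plin (-1) _ _ P1 P1; rewrite scaleN1r addNr.
elim/big_rec: _ => // m v _ Pv.
rewrite /= -to_env_scale; apply: (Plin _ _ _ _ Pv).
rewrite (rmorph_prod (@to_env R N)).
by elim/big_rec: _ => // i w _; apply: Pinj.
Qed.

Lemma env_injB x y : env_inj (x - y) = env_inj x - env_inj y.
Proof. exact: raddfB. Qed.

Fact env_ad_linear p x : linear (env_ad p x).
Proof.
move=> k u v; rewrite /env_ad env_par_ifD env_par_ifZ.
by rewrite alg_br_D2 alg_br_Z.
Qed.
HB.instance Definition _ p x :=
  GRing.isLinear.Build C env env _ (env_ad p x) (env_ad_linear p x).

Lemma env_adD p x u v : env_ad p x (u + v) = env_ad p x u + env_ad p x v.
Proof. exact: raddfD. Qed.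

Lemma env_adDl p x y u : env_ad p (x + y) u = env_ad p x u + env_ad p y u.
Proof. by rewrite /env_ad env_injD mulrDl mulrDr opprD addrACA. Qed.

Lemma env_adZl p k x u : env_ad p (k *: x) u = k *: env_ad p x u.
Proof. by rewrite /env_ad env_injZ -scalerAl -scalerAr scalerBr. Qed.

Lemma env_ad0l p u : env_ad p 0 u = 0.
Proof. by rewrite /env_ad raddf0 mul0r mulr0 subrr. Qed.

Lemma env_adM p x u v :
  env_ad p x (u * v) = env_ad p x u * v + env_par_if p u * env_ad p x v.
Proof. rewrite /env_ad env_par_ifM; exact: alg_br_M. Qed.

Lemma env_ad_inj p q x y : qhomog p x -> qhomog q y ->
  env_ad p x (env_inj y) = env_inj (qbr x y).
Proof.
move=> px qy; rewrite /env_ad (env_par_if_inj p qy) (env_inj_br px qy).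
by rewrite scalerAl.
Qed.

Lemma env_ad_inj_even x y : qhomog false x ->
  env_ad false x (env_inj y) = env_inj (qbr x y).
Proof.
move=> px; rewrite -(qcomp_sum y) qbrDr !env_injD env_adD.
by rewrite !(env_ad_inj px (qcomp_homog _ _)).
Qed.

Lemma env_par_if_sign p q u :
  env_par_if p (env_par_if q u) = env_par_if (p (+) q) u.
Proof. by case: p q => -[] //=; rewrite env_parK. Qed.

Lemma env_par_ifB p u v : env_par_if p (u - v) = env_par_if p u - env_par_if p v.
Proof. by case: p => //; apply: raddfB. Qed.

Lemma env_par_if_ad p q y u : qhomog q y ->
  env_par_if p (env_ad q y u)
  = (-1) ^+ (p && q) *: env_inj y * env_par_if p u
    - env_par_if (p (+) q) u * ((-1) ^+ (p && q) *: env_inj y).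
Proof.
move=> qy; rewrite /env_ad env_par_ifB; congr (_ - _).
  by rewrite env_par_ifM (env_par_if_inj p qy).
by rewrite env_par_ifM (env_par_if_inj p qy) env_par_if_sign.
Qed.

Lemma env_ad_jacobi p q x y u : qhomog p x -> qhomog q y ->
  env_ad p x (env_ad q y u)
  = (-1) ^+ (p && q) *: env_ad q y (env_ad p x u) + env_ad (p (+) q) (qbr x y) u.
Proof.
move=> px qy; have s1 : (-1) ^+ (p && q) * (-1) ^+ (p && q) = 1 :> C.
  by rewrite -signr_addb addbb.
have Ep := env_par_if_ad p u qy; have Eq := env_par_if_ad q u px.
have Eb := env_inj_br px qy.
rewrite andbC addbC in Eq.
rewrite {1}/env_ad Ep [env_ad q y (env_ad p x u)]/env_ad Eq.
rewrite /env_ad Eb.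
exact: (alg_jacobi (env_inj x) (env_inj y) u _ _ _ s1).
Qed.

(** An even ad x is a derivation, so the orders of nilpotency add up. *)
Lemma env_ad_nil_mul x u v n m :
  iter n (env_ad false x) u = 0 -> iter m (env_ad false x) v = 0 ->
  iter (n + m) (env_ad false x) (u * v) = 0.
Proof.
elim: n m u v => [m u v u0 _|n IHn];
  first by rewrite [u]u0 mul0r; apply: iter_linear0.
elim=> [u v _ v0|m IHm u v un vm];
  first by rewrite [v]v0 mulr0; apply: iter_linear0.
rewrite addSn iterSr env_adM (iter_linearD (env_ad false x)).
rewrite IHn ?add0r //; last by rewrite -iterSr.
by rewrite addnS -addSn IHm // -iterSr.
Qed.
End Env.

(** * Finiteness of the grading and nondegeneracy of the form on g_(-1) *)

Section Grading.
Variables (R : realType) (N : nat).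
Local Notation C := R[i].
Local Notation queer := (queer R N).
Variables (chi : {scalar queer}) (G : int -> {vspace queer}).
Hypotheses (chi_nilp : nilpotent_functional chi) (G_good : good_grading chi G).
Implicit Types (x y : queer) (j k : int) (J : seq int).

Lemma grading_sub J j : j \in J -> (G j <= \sum_(i <- J) G i)%VS.
Proof.
elim: J => // a J IH; rewrite inE big_cons => /orP[/eqP->|/IH jJ].
  exact: addvSl.
exact: subv_trans jJ (addvSr _ _).
Qed.

Lemma grading_indep J j x : uniq J -> j \notin J ->
  x \in G j -> x \in (\sum_(i <- J) G i)%VS -> x = 0.
Proof.
case: G_good => -[G_dir _ _ _] _ _ _ uJ jJ xj xJ.
have ujJ : uniq (j :: J) by rewrite /= jJ.
have := G_dir _ uJ; have := G_dir _ ujJ; rewrite !directvE /= !big_cons.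
move=> /eqP dj /eqP dJ; have := dimv_add_leqif (G j) (\sum_(i <- J) G i).
rewrite {}dj dJ => /leqifP.
case: ifP => [/subvP capx _|_]; last by rewrite ltnn.
by apply/eqP; rewrite -memv0; apply: capx; rewrite memv_cap xj.
Qed.

Lemma grading_subS J J' : {subset J <= J'} ->
  (\sum_(i <- J) G i <= \sum_(i <- J') G i)%VS.
Proof.
move=> JJ'; rewrite big_seq; elim/big_rec: _ => [|j U jJ UJ']; first exact: sub0v.
by rewrite subv_add UJ' grading_sub // JJ'.
Qed.

Lemma gr_span_seq (P : pred int) x : gr_span G P x ->
  exists2 J, {in J, forall j, P j} & x \in (\sum_(i <- J) G i)%VS.
Proof.
move=> [s sP ->]; exists (map fst s); first by move=> j /mapP[t /sP[Pt _] ->].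
rewrite [X in X \in _]big_seq; apply: rpred_sum => t ts; have [_ tG] := sP t ts.
by apply: (subvP (grading_sub _) _ tG); rewrite map_f.
Qed.

(** g is finite dimensional: a basis involves finitely many degrees, and by
    directness no other degree occurs. *)
Lemma grading_bounded : exists B, forall j x, j < B -> x \in G j -> x = 0.
Proof.
have [J Jfull] : exists J, forall x, x \in (\sum_(i <- J) G i)%VS.
  have cover (X : seq queer) :
      exists J, {in X, forall x, x \in (\sum_(i <- J) G i)%VS}.
    elim: X => [|a X [J JX]]; first by exists [::].
    have [[_ G_span _ _] _ _ _] := G_good.
    have [J' _ aJ'] := gr_span_seq (G_span a).
    exists (J' ++ J) => x /[!inE] /orP[/eqP->|/JX xJ].
      by apply: (subvP (grading_subS _) _ aJ') => j /[!mem_cat] ->.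
    by apply: (subvP (grading_subS _) _ xJ) => j /[!mem_cat] ->; rewrite orbT.
  have [J /span_subvP Jb] := cover (vbasis {:queer}).
  exists J => x; apply: (subvP Jb).
  by rewrite (span_basis (vbasisP _)) memvf.
have [B JB] : exists B, {in J, forall j, B <= j}.
  elim: {Jfull} J => [|j J' [B JB]]; first by exists 0.
  exists (Num.min B j) => k; rewrite inE ge_min => /orP[/eqP->|/JB ->//].
  by rewrite lexx orbT.
exists B => j x jB xj; apply: (grading_indep (undup_uniq J) _ xj).
  by rewrite mem_undup; apply/negP => /JB; rewrite leNgt jB.
by apply: (subvP (grading_subS _) _ (Jfull x)) => i; rewrite mem_undup.
Qed.

(** Brackets of x with the degrees other than -1 are killed by chi for degree
    reasons, so x would be in the centralizer of chi, which lies in nonnegative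
    degrees. *)
Lemma pairing_nondeg x : x \in G (-1) ->
  (forall y, y \in G (-1) -> chi (qbr x y) = 0) -> x = 0.
Proof.
move=> xG x0; have [[_ G_span _ Gbr] _ chiG G_pos] := G_good.
have [|J Jpos xJ] := gr_span_seq (G_pos x _).
  move=> y; have [s sG ->] := G_span y.
  rewrite raddf_sum raddf_sum big_seq big1 // => t /sG[_ tG] /=.
  have [t1|t1] := eqVneq t.1 (-1); first by apply: x0; rewrite -t1.
  apply: chiG (Gbr _ _ _ _ xG tG).
  by apply: contraNneq t1 => E; apply/eqP/(addrI (-1)); rewrite E.
apply: (grading_indep (undup_uniq J) _ xG).
  by rewrite mem_undup; apply/negP => /Jpos.
by apply: (subvP (grading_subS _) _ xJ) => i; rewrite mem_undup.
Qed.

Lemma pairing_dual p x : qhomog p x -> x \in G (-1) -> x != 0 ->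
  exists w, [/\ w \in G (-1), qhomog p w & chi (qbr w x) = 1].
Proof.
move=> px xG /eqP x_neq0; have [[_ _ Gc _] _ _ _] := G_good.
have [y yG y_neq0] : exists2 y, y \in G (-1) & chi (qbr x y) != 0.
  apply: contrapT => noy; apply: x_neq0; apply: pairing_nondeg => // y yG.
  by apply/eqP; apply: contrapT => /negP y_neq0; apply: noy; exists y.
have chiN u : chi (- u) = - chi u by apply: raddfN.
have chiZ (k : C) u : chi (k *: u) = k * chi u by apply: linearZ.
have chiE z : chi (qbr (qcomp p z) x) = - ((-1) ^+ p * chi (qbr x z)).
  rewrite (qbr_anti px (qcomp_homog p z)) andbb chiN chiZ.
  by rewrite -(chi_qbr_comp chi_nilp) qcomp_id.
pose c := - ((-1) ^+ p * (chi (qbr x y))^-1).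
exists (qcomp p (c *: y)); split; [by apply/Gc/rpredZ|exact: qcomp_homog|].
rewrite chiE qbrZr chiZ /c mulNr mulrN opprK mulrA mulrA.
by rewrite -signr_addb addbb mul1r mulVf.
Qed.
End Grading.

(** * The operators ad b and the left ideals I_l *)

Section AdNilpotent.
Variables (R : realType) (N : nat).
Local Notation C := R[i].
Local Notation queer := (queer R N).
Local Notation env := (env R N).
Variables (chi : {scalar queer}) (G : int -> {vspace queer}).
Hypotheses (G_good : good_grading chi G).
Variable w : queer.
Hypotheses (wG : w \in G (-1)) (w_even : qhomog false w).
Let D : {linear env -> env} := env_ad false w.

(** ad w lowers the degree by one and the degrees are bounded below. *)
Lemma env_ad_nil_inj (x : queer) : exists n, iter n D (env_inj x) = 0.
Proof.
have [B GB] := grading_bounded G_good.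
have [[_ G_span _ Gbr] _ _ _] := G_good.
have [s sG ->] := G_span x; rewrite big_seq.
elim/big_rec: _ => [|t z /sG[_ tG] [n zn]]; first by exists 0%N; rewrite /= raddf0.
have iterE m : iter m D (env_inj t.2) = env_inj (iter m (qbr w) t.2).
  by elim: m => //= m ->; rewrite /D env_ad_inj_even.
have iterG m : iter m (qbr w) t.2 \in G (t.1 - m%:Z).
  elim: m => [|m IH]; first by rewrite subr0.
  by rewrite iterS intS opprD addrCA; apply: Gbr.
pose m := `|t.1 - B|.+1; exists (maxn m n); rewrite env_injD iter_linearD.
rewrite (iter_linear_le (leq_maxr m n) zn) addr0.
apply: (iter_linear_le (leq_maxl m n)); rewrite iterE.
rewrite (GB _ _ _ (iterG m)) ?raddf0 // /m ltrBlDr -ltrBlDl.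
by rewrite intS abszE (le_lt_trans (ler_norm _)) // ltrDr.
Qed.

Lemma env_ad_nil (u : env) : exists n, iter n D u = 0.
Proof.
elim/env_ind: u => [|x u [n un]|k u v [n un] [m vm]].
- by exists 1%N; rewrite /= /D /env_ad mulr1 mul1r subrr.
- have [m xm] := env_ad_nil_inj x; exists (m + n)%N.
  exact: env_ad_nil_mul.
exists (maxn n m); rewrite iter_linear.
rewrite (iter_linear_le (leq_maxl n m) un) (iter_linear_le (leq_maxr n m) vm).
by rewrite scaler0 addr0.
Qed.
End AdNilpotent.

Section Ideal.
Variables (R : realType) (N : nat).
Local Notation C := R[i].
Local Notation queer := (queer R N).
Local Notation env := (env R N).
Variables (chi : {scalar queer}) (G : int -> {vspace queer}).
Hypotheses (chi_nilp : nilpotent_functional chi) (G_good : good_grading chi G).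
Implicit Types (l : {vspace queer}) (y z : env) (a b : queer).

Lemma mset_gr l j a : j <= - 2%:Z -> a \in G j -> mset G l a.
Proof. by move=> j2 aG; apply: mset_low; apply: gr_span_mem aG. Qed.

Lemma isotropic0 : isotropic chi G 0%VS.
Proof.
split; first exact: sub0v.
  by move=> p x; rewrite !memv0 => /eqP->; case: p.
by move=> x y; rewrite memv0 => /eqP-> _; rewrite qbr0l raddf0.
Qed.

Section Compare.
Variables k l : {vspace queer}.
Hypothesis kl : (k <= l)%VS.

Lemma mset_mono a : mset G k a -> mset G l a.
Proof. by move=> [u [v [uk vG ->]]]; exists u, v; split=> //; apply: (subvP kl). Qed.

Lemma mset'_anti a : mset' chi G l a -> mset' chi G k a.
Proof.
move=> [u [v [[uG u0] vG ->]]]; exists u, v; split=> //; split=> // y yk.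
exact/u0/(subvP kl).
Qed.

Lemma Wideal_mono y : y \in Wideal chi G k -> y \in Wideal chi G l.
Proof.
move=> /asboolP[s sG ->]; apply/asboolP; exists s => // t /sG[p [a [pa ma ->]]].
by exists p, a; split=> //; apply: mset_mono.
Qed.

Lemma Winv_mono y : Winv chi G k y -> Winv chi G l y.
Proof. by move=> Wy b mb; apply/Wideal_mono/Wy/mset'_anti. Qed.
End Compare.

Section OneIdeal.
Variable l : {vspace queer}.
Hypothesis l_iso : isotropic chi G l.
Local Notation I := (Wideal chi G l).

Lemma WidealB y z : y \in I -> z \in I -> y - z \in I.
Proof. by move=> yI zI; rewrite -scaleN1r; apply: rpredD => //; apply: rpredZ. Qed.

Lemma Winv_ad y : Winv chi G l y <->
  forall p b, qhomog p b -> mset' chi G l b -> env_ad p b y \in I.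
Proof. exact: WinvP. Qed.

Lemma Wideal_ad p b y : qhomog p b -> mset' chi G l b -> y \in I ->
  env_ad p b y \in I.
Proof. by move=> pb mb yI; apply: (proj1 (Winv_ad y)) mb => //; apply: Wideal_Winv. Qed.

Lemma Wideal_gen_sub a : mset G l a -> env_inj a - (chi a)%:A \in I.
Proof.
move=> ma; rewrite -(qcomp_sum a) env_injD raddfD scalerDl opprD addrACA.
by apply: rpredD; apply: (@Wideal_gen _ _ chi _ _ _ _ (qcomp_homog _ _));
  apply: (mset_comp G_good l_iso).
Qed.

Lemma Wideal_chi a y : mset G l a -> y * env_inj a - chi a *: y \in I.
Proof.
by move=> ma; rewrite -mulr_algr -mulrBr; apply/Wideal_Ml/Wideal_gen_sub.
Qed.

(** I_l is a left ideal that is also stable under right multiplication by m'_l,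
    because chi vanishes on [m'_l, m_l]. *)
Lemma Wideal_Mr_homog q b y : qhomog q b -> mset' chi G l b -> y \in I ->
  y * env_inj b \in I.
Proof.
move=> qb mb /asboolP[s sG ->]; rewrite mulr_suml big_seq.
apply: rpred_sum => t /sG [p [a [pa ma ->]]]; rewrite -mulrA; apply: Wideal_Ml.
have [mba cba] := mset_br G_good l_iso mb ma.
have := Wideal_inj chi_nilp G_good l_iso mba cba; rewrite (env_inj_br qb pa).
have : (-1) ^+ (q && p) * chi a = chi a.
  by case: p pa => [/(chi_odd chi_nilp)->|_]; rewrite ?mulr0 // andbF mul1r.
have : (-1) ^+ (q && p) * (-1) ^+ (q && p) = 1 :> C by rewrite -signr_addb addbb.
have := Wideal_gen chi pa ma.
move: (_ ^+ _) (env_inj a) (env_inj b) (chi a) => e A B c gI e1 ec zI.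
rewrite (alg_gen_swapr A B e1 ec).
apply: WidealB; apply: rpredZ; last exact: zI.
exact: (Wideal_Ml _ gI).
Qed.

Lemma Wideal_Mr b y : mset' chi G l b -> y \in I -> y * env_inj b \in I.
Proof.
move=> mb yI; rewrite -(qcomp_sum b) env_injD mulrDr.
by apply: rpredD; apply: (Wideal_Mr_homog (qcomp_homog _ _) _ yI);
  apply: (mset'_comp chi_nilp G_good l_iso).
Qed.
End OneIdeal.
End Ideal.

(** * Enlarging an isotropic subspace by one dimension *)

(** Named to carry its linear structure. *)
Definition env_mulr (R : realType) (N : nat) (v y : env R N) : env R N := y * v.

Fact env_mulr_linear (R : realType) (N : nat) (v : env R N) :
  linear (env_mulr v).
Proof. by move=> a y z; rewrite /env_mulr mulrDl -scalerAl. Qed.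
HB.instance Definition _ (R : realType) (N : nat) (v : env R N) :=
  GRing.isLinear.Build R[i] (env R N) (env R N) _ (env_mulr v)
    (env_mulr_linear v).

(** The setting is l = k + C v with k = ker <w, .>, both w and v being of
    parity p and <w, v> = 1, the kernel being taken in l; I and J
    denote the left ideals of k and l. *)
Section Step.
Variables (R : realType) (N : nat).
Local Notation C := R[i].
Local Notation queer := (queer R N).
Local Notation env := (env R N).
Variables (chi : {scalar queer}) (G : int -> {vspace queer}).
Hypotheses (chi_nilp : nilpotent_functional chi) (G_good : good_grading chi G).
Variables (k l : {vspace queer}) (p : bool) (w v : queer).
Hypotheses (k_iso : isotropic chi G k) (l_iso : isotropic chi G l).
Hypotheses (kl : (k <= l)%VS) (wG : w \in G (-1)) (vl : v \in l).
Hypotheses (pw : qhomog p w) (pv : qhomog p v) (wv : chi (qbr w v) = 1).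
Hypotheses (k_perp : forall x, x \in k -> chi (qbr w x) = 0).
Hypotheses (k_dec : forall x, x \in l -> x - chi (qbr w x) *: v \in k).
Implicit Types (x y z : env) (a b : queer).
Local Notation I := (Wideal chi G k).
Local Notation J := (Wideal chi G l).

Let Gbr i j a b : a \in G i -> b \in G j -> qbr a b \in G (i + j).
Proof. by have [[_ _ _ +] _ _ _] := G_good; apply. Qed.

Let vG : v \in G (-1).
Proof. by have [/subvP lG _ _] := l_iso; apply: lG. Qed.

Let mw : mset' chi G k w.
Proof. by exists w, 0; split; [split|exact: gr_span0|rewrite addr0]. Qed.

Let mlv : mset G l v.
Proof. by exists v, 0; split=> //; [exact: gr_span0|rewrite addr0]. Qed.

Let mv : mset' chi G k v.
Proof. exact: (mset'_anti kl (mset_sub l_iso mlv)). Qed.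

Let chi_v : chi v = 0.
Proof. by have [_ _ chiG _] := G_good; apply: chiG vG. Qed.

Let Jv : env_inj v \in J.
Proof. exact: (Wideal_inj chi_nilp G_good l_iso mlv chi_v). Qed.

(** J = I + U(g) v: if u is the component in l of an element a of m_l, the
    generators attached to a and to a - <w, u> v differ by a multiple of v, and
    the latter belongs to I. *)
Lemma Wideal_step y : y \in J -> exists z, y - z * env_inj v \in I.
Proof.
move=> /asboolP[s sG ->]; rewrite big_seq.
elim/big_rec: _ => [|t y' /sG[q [a [qa [u [a' [ul aG aE]] ->]]]] [z zI]].
  by exists 0; rewrite mul0r subrr; apply: rpred0.
exists (chi (qbr w u) *: t.1 + z).
have chiv (c : C) : chi (c *: v) = 0.
  have -> : chi (c *: v) = c * chi v by apply: linearZ.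
  by rewrite chi_v mulr0.
have ma : mset G k (a - chi (qbr w u) *: v).
  by exists (u - chi (qbr w u) *: v), a'; rewrite aE addrAC; split=> //; apply: k_dec.
have := Wideal_Ml t.1 (Wideal_gen_sub G_good k_iso ma).
have -> : chi (a - chi (qbr w u) *: v) = chi a.
  have -> : chi (a - chi (qbr w u) *: v) = chi a - chi (chi (qbr w u) *: v).
    exact: raddfB.
  by rewrite chiv subr0.
move=> tI.
rewrite alg_split_gen -env_injZ -env_injB.
exact: rpredD tI zI.
Qed.

Lemma ad_mulr_comm y :
  env_ad p w (y * env_inj v) - (env_ad p w y * env_inj v + env_par_if p y) \in I.
Proof.
rewrite env_adM (env_ad_inj pw pv) opprD addrA [_ - _ * _]addrC addKr.
have m : mset G k (qbr w v) by apply: (mset_gr k _ (Gbr wG vG)).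
by have := Wideal_chi G_good k_iso (env_par_if p y) m; rewrite wv scale1r.
Qed.

Lemma Wideal_sub_trans y z : y - z \in I -> z \in I -> y \in I.
Proof. by move=> yz zI; rewrite -(subrK z y); apply: rpredD yz zI. Qed.

Lemma Wideal_sub_sym y z : y - z \in I -> z - y \in I.
Proof. by move=> yz; rewrite -opprB -scaleN1r; apply: rpredZ yz. Qed.

Lemma step_inj_even y : p = false -> y \in J -> env_ad p w y \in I -> y \in I.
Proof.
move=> p0 /Wideal_step[z zI] wI.
have dI u : u \in I -> env_ad p w u \in I by apply: (Wideal_ad chi_nilp G_good k_iso).
have xI u : u \in I -> env_mulr (env_inj v) u \in I.
  by apply: (Wideal_Mr chi_nilp G_good k_iso).
apply: (Wideal_sub_trans zI); apply: (xI z).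
apply: (weyl_mod_inj dI xI).
- by move=> u; have := ad_mulr_comm u; rewrite p0.
- by rewrite p0; apply: (env_ad_nil G_good wG); rewrite -p0.
apply: Wideal_sub_trans wI; rewrite -raddfB /=.
exact/dI/Wideal_sub_sym.
Qed.

Lemma step_lift_even y : p = false ->
  exists y', y' - y \in J /\ env_ad p w y' \in I.
Proof.
move=> p0.
have dI u : u \in I -> env_ad p w u \in I by apply: (Wideal_ad chi_nilp G_good k_iso).
have xI u : u \in I -> env_mulr (env_inj v) u \in I.
  by apply: (Wideal_Mr chi_nilp G_good k_iso).
have [] := @weyl_mod_lift _ _ (Wideal chi G k) (env_ad p w)
  (env_mulr (env_inj v)) dI xI _ _ y.
- by move=> u; have := ad_mulr_comm u; rewrite p0.
- by rewrite p0; apply: (env_ad_nil G_good wG); rewrite -p0.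
move=> z zI; exists (y + z * env_inj v); split=> //.
by rewrite [y + _]addrC addrK; apply: Wideal_Ml Jv.
Qed.

(** This is the Jacobi identity for the odd element w. *)
Lemma ad_sqr_odd y : p = true ->
  env_ad p w (env_ad p w y) = 2^-1 *: env_ad false (qbr w w) y.
Proof.
move=> p1; have := env_ad_jacobi y pw pw; rewrite p1 /= expr1 scaleN1r.
move: (env_ad true w _) (env_ad false _ y) => a b ab.
have <- : a + a = b by rewrite {2}ab addrA subrr add0r.
by rewrite env_half.
Qed.

Lemma env_par_ad_odd y : p = true ->
  env_par (env_ad p w y) = - env_ad p w (env_par y).
Proof.
move=> p1; have := env_par_if_ad true y pw.
rewrite p1 /= expr1 scaleN1r /env_ad /= env_parK => ->.
by rewrite mulNr mulrN opprB opprK addrC.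
Qed.

(** v^2 is half of [v, v], on which chi vanishes as l is isotropic. *)
Lemma mulvv_odd y : p = true -> y * env_inj v * env_inj v \in I.
Proof.
move=> p1; have m : mset G k (qbr v v) by apply: (mset_gr k _ (Gbr vG vG)).
have c0 : chi (qbr v v) = 0 by have [_ _ + ] := l_iso; apply.
have := Wideal_inj chi_nilp G_good k_iso m c0.
rewrite (env_inj_br pv pv) p1 /= expr1 scaleN1r opprK => vvI.
rewrite -mulrA; apply: Wideal_Ml.
by rewrite -[_ * env_inj v]env_half; apply: rpredZ vvI.
Qed.

Lemma Wideal_par_rev y : env_par y \in I -> y \in I.
Proof. by move=> /(Wideal_par chi_nilp); rewrite env_parK. Qed.

(** If y = z v modulo I then y v = z v^2 vanishes modulo I, and applying ad w
    to it gives (ad w y) v + y^(1), whose first term vanishes as well. *)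
Lemma step_inj_odd y : p = true -> y \in J -> env_ad p w y \in I -> y \in I.
Proof.
move=> p1 /Wideal_step[z zI] wI.
have yvI : y * env_inj v \in I.
  apply: Wideal_sub_trans (mulvv_odd z p1); rewrite -mulrBl.
  exact: (Wideal_Mr chi_nilp G_good k_iso mv zI).
have DyvI := Wideal_ad chi_nilp G_good k_iso pw mw yvI.
have := Wideal_sub_trans (Wideal_sub_sym (ad_mulr_comm y)) DyvI.
rewrite p1 /= => sI; apply: Wideal_par_rev.
have wvI := Wideal_Mr chi_nilp G_good k_iso mv wI.
rewrite -[env_par y](addKr (env_ad true w y * env_inj v)) addrC.
by rewrite p1 in wvI; apply: WidealB sI wvI.
Qed.

(** The candidate is the parity conjugate of ad w (y v); by [ad_mulr_comm] it
    differs from y by a multiple of v modulo I.  It is killed by ad w because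
    ad [w, w] (y v) is congruent to (ad [w, w] y) v, which is a multiple of v^2
    by the invariance of y. *)
Lemma step_lift_odd y : p = true -> Winv chi G l y ->
  exists y', y' - y \in J /\ env_ad p w y' \in I.
Proof.
move=> p1 Wy; exists (env_par (env_ad p w (y * env_inj v))); split.
  have dI := Wideal_mono kl (Wideal_par chi_nilp (ad_mulr_comm y)).
  have tJ : env_par (env_ad p w y * env_inj v) \in J.
    by apply: (Wideal_par chi_nilp); apply: Wideal_Ml Jv.
  have pE : env_par (env_par_if p y) = y by rewrite p1 /= env_parK.
  have := rpredD dI tJ; rewrite env_parB.
  rewrite (env_parD (env_ad p w y * env_inj v)) pE.
  by rewrite opprD addrA addrAC subrK.
rewrite -[X in X \in _]opprK -(env_par_ad_odd _ p1) -scaleN1r.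
apply: rpredZ; apply: (Wideal_par chi_nilp); rewrite (ad_sqr_odd _ p1).
apply: rpredZ; rewrite env_adM.
have bG : qbr w w \in G (- 2%:Z) by apply: (Gbr wG wG).
have pb : qhomog false (qbr w w) by have := qbr_homog pw pw; rewrite addbb.
apply: rpredD; last first.
  (* [[w, w], v] has degree -3, where chi vanishes. *)
  rewrite (env_ad_inj_even _ pb); apply: Wideal_Ml.
  have bvG := Gbr bG vG; apply: (Wideal_inj chi_nilp G_good k_iso).
    by apply: (mset_gr k _ bvG).
  by have [_ _ chiG _] := G_good; apply: chiG bvG.
have bJ : env_ad false (qbr w w) y \in J.
  apply: (proj1 (Winv_ad chi_nilp G_good l_iso y) Wy) => //.
  exact: (mset_sub l_iso (mset_gr l _ bG)).
have [z zI] := Wideal_step bJ.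
apply: Wideal_sub_trans (mulvv_odd z p1); rewrite -mulrBl.
exact: (Wideal_Mr chi_nilp G_good k_iso mv zI).
Qed.

Lemma step_inj y : y \in J -> env_ad p w y \in I -> y \in I.
Proof.
have [p1|p0] : p = true \/ p = false by case: (p); [left|right].
  exact: step_inj_odd.
exact: step_inj_even.
Qed.

Lemma step_lift y : Winv chi G l y ->
  exists y', y' - y \in J /\ env_ad p w y' \in I.
Proof.
move=> Wy; have [p1|p0] : p = true \/ p = false by case: (p); [left|right].
  exact: step_lift_odd.
exact: step_lift_even.
Qed.

Section LiftInvariant.
Variable y : env.
Hypotheses (Wy : Winv chi G l y) (wy : env_ad p w y \in I).

(** By Jacobi, ad w kills ad b y modulo I; being in J, it is then in I. *)
Lemma ad_descent q b : qhomog q b -> mset' chi G l b ->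
  env_ad (p (+) q) (qbr w b) y \in I -> env_ad q b y \in I.
Proof.
move=> qb mb wb; apply: step_inj.
  exact: (proj1 (Winv_ad chi_nilp G_good l_iso y) Wy).
rewrite (env_ad_jacobi y pw qb); apply: rpredD wb; apply: rpredZ.
exact: (Wideal_ad chi_nilp G_good k_iso qb (mset'_anti kl mb) wy).
Qed.

(** Induction on the distance of the degree of b to the lower bound of the
    grading: [w, b] is one degree lower. *)
Lemma ad_low_homog q j b : qhomog q b -> j <= - 2%:Z -> b \in G j ->
  env_ad q b y \in I.
Proof.
have [B GB] := grading_bounded G_good.
have [n jn] : exists n : nat, j < B + n%:Z.
  exists `|j - B|.+1; rewrite -ltrBlDl intS abszE (le_lt_trans (ler_norm _)) //.
  by rewrite ltrDr.
elim: n q j b jn => [|n IH] q j b jn qb j2 bG.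
  rewrite addr0 in jn; rewrite (GB _ _ jn bG) env_ad0l; exact: rpred0.
apply: (ad_descent qb); first exact: (mset_sub l_iso (mset_gr l j2 bG)).
apply: (IH _ _ _ _ (qbr_homog pw qb) _ (Gbr wG bG)).
  by rewrite addrC ltrBlDr -addrA -PoszD addn1.
by apply: le_trans j2; rewrite gerDr.
Qed.

Lemma ad_low q b : gr_span G (fun j => j <= - 2%:Z) b ->
  env_ad q (qcomp q b) y \in I.
Proof.
move=> [s sG ->]; rewrite big_seq.
elim/big_rec: _ => [|t b' /sG[t2 tG] IH].
  have -> : qcomp q 0 = 0 :> queer by case: (q).
  rewrite env_ad0l; exact: rpred0.
rewrite qcompD env_adDl; apply: rpredD IH.
apply: (ad_low_homog (qcomp_homog _ _) t2).
by have [[_ _ Gc _] _ _ _] := G_good; apply: Gc.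
Qed.

(** This is m'_k = m'_l + C w in degree -1: subtracting a multiple of w makes a
    orthogonal to v without affecting its orthogonality to k. *)
Lemma iso_perp_split a : iso_perp chi G k a ->
  iso_perp chi G l (a - chi (qbr a v) *: w).
Proof.
move=> [aG a0]; split; first by apply: rpredB => //; apply: rpredZ.
have chiD c d : chi (c - d) = chi c - chi d by apply: raddfB.
have chiZ (c : C) d : chi (c *: d) = c * chi d by apply: linearZ.
have brB c d e f : chi (qbr (c - e *: d) f) = chi (qbr c f) - e * chi (qbr d f).
  by rewrite -chiZ -qbrZl -chiD -scaleNr qbrDl !qbrZl scaleNr.
move=> x xl; rewrite brB.
have /k_dec xk := xl; have := a0 _ xk.
have -> : chi (qbr a (x - chi (qbr w x) *: v))
    = chi (qbr a x) - chi (qbr w x) * chi (qbr a v).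
  by rewrite -chiZ -qbrZr -chiD -scaleNr qbrDr !qbrZr scaleNr.
by rewrite mulrC.
Qed.

Lemma lift_inv : Winv chi G k y.
Proof.
apply/(Winv_ad chi_nilp G_good k_iso) => q b qb [u [u' [uk u'G bE]]].
have [t [c [tl uE]]] : exists t c, iso_perp chi G l t /\ u = t + c *: w.
  exists (u - chi (qbr u v) *: w), (chi (qbr u v)).
  by rewrite subrK; split=> //; apply: iso_perp_split.
rewrite -(qcomp_id qb) bE uE !qcompD !env_adDl.
apply: rpredD; last exact: ad_low.
apply: rpredD.
  apply: (ad_descent (qcomp_homog _ _)).
    exists (qcomp q t), 0.
    split; [exact: (iso_perp_comp chi_nilp G_good l_iso)|exact: gr_span0|].
    by rewrite addr0.
  apply: (@ad_low_homog _ (-1 - 1) _ (qbr_homog pw (qcomp_homog _ _))) => //.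
  have [[_ _ Gc _] _ _ _] := G_good; apply: (Gbr wG); apply: Gc.
  by have [] := tl.
rewrite qcompZ env_adZl; apply: rpredZ.
have [->|qp] := eqVneq q p; first by rewrite (qcomp_id pw).
have -> : q = ~~ p by case: (q) qp; case: (p).
rewrite (qcomp_neg pw) env_ad0l; exact: rpred0.
Qed.
End LiftInvariant.
End Step.

(** * Comparison with the zero subspace and the isomorphism *)

Section Compare.
Variables (R : realType) (N : nat).
Local Notation C := R[i].
Local Notation queer := (queer R N).
Local Notation env := (env R N).
Variables (chi : {scalar queer}) (G : int -> {vspace queer}).
Hypotheses (chi_nilp : nilpotent_functional chi) (G_good : good_grading chi G).
Implicit Types (l : {vspace queer}) (y : env).

Definition pairing (w x : queer) : C^o := chi (qbr w x).

Fact pairing_linear w : linear (pairing w).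
Proof. by move=> a x y; rewrite /pairing qbrDr qbrZr linearP. Qed.
HB.instance Definition _ w :=
  GRing.isLinear.Build C queer C^o _ (pairing w) (pairing_linear w).

Lemma pairing_ker w l x :
  (x \in (l :&: lker (linfun (pairing w)))%VS) = (x \in l) && (chi (qbr w x) == 0).
Proof. by rewrite memv_cap memv_ker lfunE. Qed.

Lemma isotropic_cut p w l : qhomog p w -> isotropic chi G l ->
  isotropic chi G (l :&: lker (linfun (pairing w))).
Proof.
move=> pw [lG lc l0]; split; first exact: subv_trans (capvSl _ _) lG.
  move=> q x; rewrite !pairing_ker => /andP[xl /eqP x0].
  rewrite lc //= -(chi_qbr_comp chi_nilp).
  have [->|qp] := eqVneq q p; first by rewrite (qcomp_id pw) x0.
  have -> : q = ~~ p by case: (q) qp; case: (p).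
  by rewrite (qcomp_neg pw) qbr0l raddf0.
by move=> x y; rewrite !pairing_ker => /andP[xl _] /andP[yl _]; apply: l0.
Qed.

Lemma homog_vector l : isotropic chi G l -> l != 0%VS ->
  exists p v, [/\ qhomog p v, v \in l & v != 0].
Proof.
move=> [_ lc _]; rewrite -vpick0 => v0.
have [c0|c0] := eqVneq (qcomp false (vpick l)) 0; last first.
  by exists false, (qcomp false (vpick l)); rewrite qcomp_homog lc ?memv_pick.
exists true, (qcomp true (vpick l)); rewrite qcomp_homog lc ?memv_pick //; split=> //.
by apply: contraNneq v0 => c1; rewrite -(qcomp_sum (vpick l)) c0 c1 addr0.
Qed.

(** The two parts say that W_0 -> W_l is injective and surjective.  The
    induction runs through k, the kernel of a functional <w, .> on l. *)
Lemma Winv_compare l : isotropic chi G l ->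
  (forall y, Winv chi G 0 y -> y \in Wideal chi G l -> y \in Wideal chi G 0)
  /\ (forall y, Winv chi G l y ->
        exists y', Winv chi G 0 y' /\ y' - y \in Wideal chi G l).
Proof.
have [n] := ubnP (\dim l); elim: n l => // n IH l; rewrite ltnS => ln l_iso.
have [l0|l_neq0] := eqVneq l 0%VS.
  rewrite l0; split=> // y Wy; exists y; rewrite subrr; split=> //.
  exact: rpred0.
have [p [v [pv vl v_neq0]]] := homog_vector l_iso l_neq0.
have vG : v \in G (-1) by have [/subvP lG _ _] := l_iso; apply: lG.
have [w [wG pw wv]] := pairing_dual chi_nilp G_good pv vG v_neq0.
pose k := (l :&: lker (linfun (pairing w)))%VS.
have kl : (k <= l)%VS := capvSl _ _.
have k_iso := isotropic_cut pw l_iso : isotropic chi G k.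
have k_perp x : x \in k -> chi (qbr w x) = 0.
  by rewrite pairing_ker => /andP[_ /eqP].
have k_dec x : x \in l -> x - chi (qbr w x) *: v \in k.
  move=> xl; rewrite pairing_ker; apply/andP; split.
    by apply: rpredB => //; apply: rpredZ.
  have chiB c d : chi (c - d) = chi c - chi d by apply: raddfB.
  have chiZ (c : C) d : chi (c *: d) = c * chi d by apply: linearZ.
  by rewrite -scaleNr qbrDr qbrZr scaleNr chiB chiZ wv mulr1 subrr.
have kn : (\dim k < n)%N.
  apply: leq_trans ln; rewrite ltn_neqAle dimvS // andbT.
  apply: contraTneq (vl) => dkl.
  have /eqP <- : k == l by rewrite eqEdim kl dkl /=.
  by rewrite pairing_ker wv oner_eq0 andbF.
have [k_inj k_lift] := IH k kn k_iso.
have mw : mset' chi G k w.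
  by exists w, 0; rewrite addr0; split=> //; apply: gr_span0.
split=> y Wy.
  move=> yl; apply: (k_inj y Wy).
  apply: (step_inj chi_nilp G_good k_iso l_iso kl wG vl pw pv wv k_perp k_dec yl).
  have Wky := Winv_mono (sub0v k) Wy.
  exact: (proj1 (Winv_ad chi_nilp G_good k_iso y) Wky p w pw mw).
have [y1 [y1y wy1]] :=
  step_lift chi_nilp G_good k_iso l_iso kl wG vl pw pv wv k_perp k_dec Wy.
have Wy1 : Winv chi G l y1.
  apply: (Winv_eq chi_nilp G_good l_iso _ Wy).
  by apply/esym/Wcoset_eq.
have Wky1 := lift_inv chi_nilp G_good k_iso l_iso kl wG vl pw pv wv k_perp k_dec
  Wy1 wy1.
have [y2 [Wy2 y2y1]] := k_lift y1 Wky1.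
exists y2; split=> //; have := Wideal_mono kl y2y1 => y2y1l.
by rewrite -(subrK y1 y2) -addrA; apply: rpredD y2y1l y1y.
Qed.
End Compare.

Section Iso.
Variables (R : realType) (N : nat).
Local Notation C := R[i].
Local Notation queer := (queer R N).
Local Notation env := (env R N).
Variables (chi : {scalar queer}) (G : int -> {vspace queer}).
Hypotheses (chi_nilp : nilpotent_functional chi) (G_good : good_grading chi G).

Let i0 := isotropic0 chi G.
Local Notation Winv0 := (Winv chi G 0).

Lemma Winv0_D y z : Winv0 y -> Winv0 z -> Winv0 (y + z).
Proof. exact: Winv_D. Qed.

Lemma Winv0_Z (c : C) y : Winv0 y -> Winv0 (c *: y).
Proof. exact: Winv_Z. Qed.

Section OneSided.
Variables (l1 l2 : {vspace queer}).
Hypotheses (l1_iso : isotropic chi G l1) (l2_iso : isotropic chi G l2).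
Local Notation W1 := (Walg chi_nilp G_good l1_iso).
Local Notation W2 := (Walg chi_nilp G_good l2_iso).

Lemma Winv0_lift_subproof (u : W1) :
  exists y, Winv0 y /\ Wcoset chi G l1 y = val u.
Proof.
have [_ lift] := Winv_compare chi_nilp G_good l1_iso.
have [y [Wy yu]] := lift _ (Wrepr_inv u).
by exists y; split=> //; rewrite -Wcoset_repr; apply/Wcoset_eq.
Qed.

(** Any choice gives the same class modulo I_0, by [Winv_compare]. *)
Definition Winv0_lift (u : W1) : env := projT1 (cid (Winv0_lift_subproof u)).

Lemma Winv0_liftP u : Winv0 (Winv0_lift u).
Proof. by rewrite /Winv0_lift; case: cid => y []. Qed.

Lemma Wcoset_Winv0_lift u : Wcoset chi G l1 (Winv0_lift u) = val u.
Proof. by rewrite /Winv0_lift; case: cid => y []. Qed.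

Definition Wmap (u : W1) : W2 :=
  Wclass chi_nilp G_good l2_iso (Winv_mono (sub0v l2) (Winv0_liftP u)).

Lemma WmapE (u : W1) y : Winv0 y -> Wcoset chi G l1 y = val u ->
  val (Wmap u) = Wcoset chi G l2 y.
Proof.
move=> Wy yu; apply/Wcoset_eq/(Wideal_mono (sub0v l2)).
have [l1_inj _] := Winv_compare chi_nilp G_good l1_iso.
apply: l1_inj; last by apply/Wcoset_eq; rewrite Wcoset_Winv0_lift.
rewrite -scaleN1r; apply: Winv0_D; first exact: Winv0_liftP.
exact: Winv0_Z.
Qed.

Fact Wmap_linear : linear Wmap.
Proof.
move=> a u v; apply: val_inj.
rewrite (@WmapE _ (a *: Winv0_lift u + Winv0_lift v)).
- by rewrite WcosetD WcosetZ.
- by apply: Winv0_D; [apply: Winv0_Z|]; apply: Winv0_liftP.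
by rewrite WcosetD WcosetZ !Wcoset_Winv0_lift.
Qed.
HB.instance Definition _ := GRing.isLinear.Build C W1 W2 _ Wmap Wmap_linear.

Fact Wmap_monoid : monoid_morphism Wmap.
Proof.
split=> [|u v]; apply: val_inj.
  by rewrite (@WmapE _ 1) //; apply: (Winv_1 chi_nilp G_good i0).
rewrite (@WmapE _ (Winv0_lift u * Winv0_lift v)).
- by apply/esym; apply: val_Wmul => //; apply/(Winv_mono (sub0v l2))/Winv0_liftP.
- exact: (Winv_M chi_nilp G_good i0 (Winv0_liftP u) (Winv0_liftP v)).
apply/esym/(@val_Wmul _ _ _ _ _ chi_nilp G_good l1_iso).
- exact/(Winv_mono (sub0v l1))/Winv0_liftP.
- by rewrite Wcoset_Winv0_lift.
by rewrite Wcoset_Winv0_lift.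
Qed.

(** The component of parity p of an invariant lift of a coset of parity p is
    again an invariant lift of it. *)
Lemma Wmap_homog p (u : W1) : Whomog p u -> Whomog p (Wmap u).
Proof.
move=> [z pz uz]; set y := Winv0_lift u.
have zE : env_comp p z = z.
  rewrite env_compE pz scalerA -signr_addb addbb scale1r; exact: env_half.
have yz : y - z \in Wideal chi G l1.
  by apply/Wcoset_eq; rewrite Wcoset_Winv0_lift.
have cyz : env_comp p y - z \in Wideal chi G l1.
  have -> : env_comp p y - z = env_comp p (y - z).
    by rewrite -{1}(subrK z y) (env_compD p (y - z) z) zE addrK.
  rewrite env_compE; apply: rpredZ; apply: (rpredD yz); apply: rpredZ.
  exact: Wideal_par.
exists (env_comp p y); first exact: env_comp_homog.
apply: WmapE; last by rewrite uz; apply/Wcoset_eq.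
rewrite env_compE; apply: Winv0_Z; apply: (Winv0_D (Winv0_liftP u)).
by apply: Winv0_Z; apply: (Winv_par chi_nilp G_good i0); apply: Winv0_liftP.
Qed.
End OneSided.

Lemma WmapK l1 l2 (l1_iso : isotropic chi G l1) (l2_iso : isotropic chi G l2) :
  cancel (@Wmap l1 l2 l1_iso l2_iso) (@Wmap l2 l1 l2_iso l1_iso).
Proof.
move=> u; apply: val_inj.
by rewrite (WmapE _ (Winv0_liftP u)) ?Wcoset_Winv0_lift.
Qed.
End Iso.

Theorem theorem3p5 (R : realType) (N : nat) (chi : {scalar queer R N})
    (G : int -> {vspace queer R N})
    (chi_nilp : nilpotent_functional chi) (G_good : good_grading chi G)
    (l1 l2 : {vspace queer R N})
    (l1_iso : isotropic chi G l1) (l2_iso : isotropic chi G l2) :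
  exists f : {linear Walg chi_nilp G_good l1_iso -> Walg chi_nilp G_good l2_iso},
    [/\ monoid_morphism f, bijective f
      & forall (p : bool) (w : Walg chi_nilp G_good l1_iso),
          Whomog p w <-> Whomog p (f w)].
Proof.
exists (Wmap l2_iso); split.
- exact: Wmap_monoid.
- by exists (Wmap l1_iso); apply: WmapK.
move=> p u; split; first exact: Wmap_homog.
by move=> /(Wmap_homog l1_iso); rewrite /= WmapK.
Qed.
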